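(* Let $E\subset\mathbb{R}^2$ be an arbitrary rectifiable set, and let $x\mapsto\theta_x$ be an arbitrary tangent field of $E$. Then there is an $E_0\subset E$ of full $\mathcal{H}^1$-measure in $E$ for which the following holds. For every path $P_0$ in $\mathbb{R}^2$, and for any neighborhood of $P_0$, there is a path $P$ in this neighborhood with the same endpoints as $P_0$, and there is a Borel mapping $p\mapsto\theta_p$ from $P$ to $\mathbb{P}^1$ such that $$\Big|\bigcup_{p\in P} \big(p+\{x\in E_0:\ \theta_x\neq \theta_p\}\big)\Big|=0.$$
   Context: $\mathcal{H}^1$ is 1-dimensional Hausdorff measure and $|\cdot|$ is Lebesgue measure on $\mathbb{R}^2$. $E_0\subset E$ has full $\mathcal{H}^1$-measure in $E$ if $\mathcal{H}^1(E\setminus E_0)=0$. A path is the image of a continuous map on a compact interval; its endpoints are the images of the endpoints of the interval. $\mathbb{P}^1\simeq\mathbb{R}/\pi\mathbb{Z}$ is the set of directions in $\mathbb{R}^2$. $E$ is rectifiable if $\mathcal{H}^1$-a.e. point of $E$ can be covered by countably many $C^1$ curves. A tangent field of $E$ is a map $x\mapsto\theta_x$ from $E$ to $\mathbb{P}^1$ such that for any $C^1$ curve $\Gamma$, the tangent direction of $\Gamma$ at $x$ equals $\theta_x$ for $\mathcal{H}^1$-a.e. $x\in\Gamma\cap E$. *)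

(* Defs.v *)
From HB Require Import structures.
From mathcomp Require Import all_boot all_order all_algebra generic_quotient.
From mathcomp Require Import all_classical all_reals all_analysis.

Set Implicit Arguments.
Unset Strict Implicit.
Unset Printing Implicit Defensive.

Import Order.TTheory GRing.Theory Num.Theory.
Import numFieldNormedType.Exports.

Local Open Scope classical_set_scope.
Local Open Scope ring_scope.
Local Open Scope quotient_scope.

(* The plane is [R * R]. The norm that the library puts on a product is the
   sup norm, so the Euclidean distance is introduced separately; the two give
   the same topology and the same C^1 maps. *)
Definition edist (R : realType) (p q : R * R) : R :=
  Num.sqrt ((p.1 - q.1) ^+ 2 + (p.2 - q.2) ^+ 2).

(* The extra 0 gives the empty set diameter 0. *)
Definition ediam (R : realType) (A : set (R * R)) : \bar R :=
  ereal_sup [set d | d = 0%E \/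
    exists p q, [/\ A p, A q & d = (edist p q)%:E]].

Definition hausdorff1_delta (R : realType) (delta : R) (A : set (R * R)) :
    \bar R :=
  ereal_inf [set s | exists U : nat -> set (R * R),
    [/\ A `<=` \bigcup_n U n,
        forall n, (ediam (U n) <= delta%:E)%E &
        s = (\sum_(0 <= n <oo) ediam (U n))%E]].

Definition hausdorff1 (R : realType) (A : set (R * R)) : \bar R :=
  ereal_sup [set hausdorff1_delta delta A | delta in [set d : R | 0 < d]].

Section directions.
Variable R : realType.

Let mod_pi' (x y : R) : bool := (x - y) / pi \is a Num.int.

Local Lemma mod_pi_refl : reflexive mod_pi'.
Proof. by move=> x; rewrite /mod_pi' subrr mul0r rpred0. Qed.

Local Lemma mod_pi_sym : symmetric mod_pi'.
Proof. by move=> x y; rewrite /mod_pi' -opprB mulNr rpredN. Qed.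

Local Lemma mod_pi_trans : transitive mod_pi'.
Proof.
move=> y x z xy yz; rewrite /mod_pi' (_ : x - z = (x - y) + (y - z)).
  by rewrite mulrDl rpredD.
by rewrite addrA subrK.
Qed.

Definition mod_pi := EquivRel mod_pi' mod_pi_refl mod_pi_sym mod_pi_trans.

(* P^1 = R / pi Z *)
Definition P1 := quotient_topology {eq_quot mod_pi}.

(* The angle class [th] is the direction of the line spanned by [v]; for
   [v != 0] there is exactly one such [th]. *)
Definition is_direction (v : R * R) (th : P1) : Prop :=
  v != 0 /\ exists r a : R, th = \pi_P1 a /\ v = (r * cos a, r * sin a).

End directions.

(* A C^1 curve is the image of [a, b] under a regular C^1 map. A map that is C^1
   on [a, b], with one-sided derivatives at the endpoints, extends to a C^1 map
   on the line, so the parametrization is taken to be defined on the line. *)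
Definition C1_curve (R : realType) (g : R -> R * R) (a b : R) : Prop :=
  [/\ a < b, (forall t, derivable g t 1), continuous g^`()%classic &
      forall t, t \in `[a, b] -> g^`()%classic t != 0].

Definition rectifiable (R : realType) (E : set (R * R)) : Prop :=
  exists (g : nat -> R -> R * R) (a b : nat -> R),
    (forall n, C1_curve (g n) (a n) (b n)) /\
    hausdorff1 (E `\` \bigcup_n (g n @` `[a n, b n])) = 0%E.

(* Only the values of [theta] on [E] matter. A curve may cross itself; the
   points at which it has more than one tangent direction form a countable set,
   hence an H^1-null one. *)
Definition tangent_field (R : realType) (E : set (R * R))
    (theta : R * R -> P1 R) : Prop :=
  forall (g : R -> R * R) (a b : R), C1_curve g a b ->
    hausdorff1 [set x | E x /\ exists t,
      [/\ t \in `[a, b], g t = x &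
          ~ is_direction (g^`()%classic t) (theta x)]] = 0%E.

Definition full_H1_measure (R : realType) (E E0 : set (R * R)) : Prop :=
  hausdorff1 (E `\` E0) = 0%E.

Definition is_path (R : realType) (P : set (R * R)) (p q : R * R) : Prop :=
  exists (a b : R) (f : R -> R * R),
    [/\ a <= b, {within `[a, b], continuous f}, P = f @` `[a, b],
        f a = p & f b = q].

Definition borel_map (R : realType) (D : set (R * R)) (f : R * R -> P1 R) :
    Prop :=
  @measurable_fun _ _ (g_sigma_algebraType (@open (R * R)%type))
    (g_sigma_algebraType (@open (P1 R))) D f.

(* A set that need not be measurable has measure 0 when it is contained in a
   Borel set of measure 0. *)
Definition lebesgue2_null (R : realType) (A : set (R * R)) : Prop :=
  (@lebesgue_measure R \x @lebesgue_measure R)%E.-negligible A.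

(* Main.v *)
Require Import Defs.
From HB Require Import structures.
From mathcomp Require Import all_boot all_order all_algebra generic_quotient.
From mathcomp Require Import all_classical all_reals all_analysis.
From mathcomp Require Import measurable_realfun ring lra.

Set Implicit Arguments.
Unset Strict Implicit.
Unset Printing Implicit Defensive.

Import Order.TTheory GRing.Theory Num.Theory.
Import numFieldNormedType.Exports.

Local Open Scope classical_set_scope.
Local Open Scope ring_scope.

(** Every point of [E], up to an H^1-null set, lies on one of countably many
C^1 curves [g n], at a parameter where [theta] is the direction of the
derivative; these points form [E0].  It is therefore enough to find, near the
given path, a path [P] with a Borel function [h : P -> [0, pi]] such that the
points [p + g n t], for [p] in [P] and [g n] having at [t] a direction of angle
in [0, pi[ other than [h p], form a null set.

Fix two disjoint arcs of angles [I_true = [0, q]] and [I_false = [q', r]] with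
[q < q' < r < pi].  The geometric core ([replaceable_arcs]) says that any
segment can be replaced, in any neighbourhood of itself, by a polygonal path
whose points carry a label [true] or [false], so that the points with label
[e], added to the parts of finitely many curves that have direction in [I_e],
cover as little area as desired.  Cut both arcs into [n] small arcs.  A
segment whose direction is the left end of a small arc sweeps little area along
the part of a curve whose direction lies in that small arc: about the length of
the segment times the length of that part, divided by [n] ([area_le_sweep]).
Once this area is paid for, the segment is replaced by a zigzag with many
teeth, one side of which goes in the direction of the next small arc and the
other in the current direction of the other arc.  The teeth are so short that
whatever replaces them sweeps along the small arc nothing beyond the area
already paid.  One continues with the teeth until one of the two arcs has been
used up, and labels the piece accordingly.  Directions in the two arcs are
transversal, so a turn multiplies the total length by at most [1 + O(1/n)]; a
branch makes at most [2n] turns, so that lengths stay bounded.  On each branch a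
part of a curve is paid for at most once, so the total cost is [O(1/n)]
([replaceable_grid]).

This replacement is carried out successively for all triples [(q, q', r)] of
rationals, infinitely often for each triple, with the areas tending to [0]
geometrically and with such small perturbations that the paths converge and
each point of the limit [P] still carries a label for each step
([limit_path]).  Given a triple, each point [p] of [P] carries one of the two
labels [e] infinitely often; then [I_e] is said to be killed at [p].  By the
Borel-Cantelli lemma, the points where [I_e] is killed sweep a null set along
the directions in [I_e].  Let [h p] be the supremum of the [q] such that some
arc [[0, q]] is killed at [p].  An angle below [h p] lies in a killed arc
[[0, q]].  An angle above [h p] lies in some [[q', r]] with [h p < q < q'];
since [[0, q]] is not killed at [p], [[q', r]] is.  Only the angle [h p]
survives, and [h] is Borel because the sets where an arc is killed are upper
limits of open sets ([null_sweep_path]). *)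

(** * Outer area of plane sets *)

Section Covers.
Variable R : realType.
Implicit Types (A B G S : set (R * R)) (c : R).

Definition mu2 : set (measurableTypeR R * measurableTypeR R) -> \bar R :=
  (@lebesgue_measure R \x @lebesgue_measure R)%E.

(** The Lebesgue outer measure of [A] is at most [c], without requiring that [A]
be measurable. *)
Definition area_le A c := exists B : set (measurableTypeR R * measurableTypeR R),
  [/\ measurable B, (mu2 B <= c%:E)%E & A `<=` B].

Lemma area_le_sub A B c c' : A `<=` B -> c <= c' -> area_le B c -> area_le A c'.
Proof.
move=> AB cc' [D [mD Dc BD]]; exists D; split => //.
  by apply: (le_trans Dc); rewrite lee_fin.
exact: subset_trans BD.
Qed.

Lemma area_le0 c : 0 <= c -> area_le set0 c.
Proof. by move=> c0; exists set0; split => //; rewrite /mu2 measure0 lee_fin. Qed.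

Lemma area_leU A B c d : area_le A c -> area_le B d -> area_le (A `|` B) (c + d).
Proof.
move=> [A' [mA Ac AA]] [B' [mB Bd BB]]; exists (A' `|` B'); split.
- exact: measurableU.
- rewrite EFinD; apply: (le_trans _ (leeD Ac Bd)).
  exact: measureU2.
- exact: setUSS.
Qed.

Lemma area_le_bigU (n : nat) (A : nat -> set (R * R)) (c : nat -> R) :
  (forall i, (i < n)%N -> area_le (A i) (c i)) ->
  area_le [set z | exists2 i, (i < n)%N & A i z] (\sum_(i < n) c i).
Proof.
elim: n => [_|n IH H].
  by rewrite big_ord0; apply: (@area_le_sub _ set0 0 0) => // [z [i]|];
      [|exact: area_le0].
rewrite big_ord_recr /=.
apply: (@area_le_sub _ ([set z | exists2 i, (i < n)%N & A i z] `|` A n)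
  (\sum_(i < n) c i + c n)) => //.
  move=> z [i]; rewrite ltnS leq_eqVlt => /predU1P[-> ?|iln Ai]; first by right.
  by left; exists i.
by apply: area_leU; [apply: IH => i ilt; apply: H; rewrite ltnS ltnW|exact: H].
Qed.

Lemma area_le_square (z0 : R * R) (r : R) : 0 <= r ->
  area_le [set z | `|z - z0| <= r] ((2 * r) ^+ 2).
Proof.
move=> r0.
have mI (x : R) : lebesgue_measure `[x - r, x + r]%classic = (2 * r)%:E.
  rewrite lebesgue_measure_itv /= lte_fin; case: ifPn => [_|].
    by rewrite -EFinB; congr EFin; ring.
  by rewrite -leNgt => h; congr EFin; lra.
exists ((`[z0.1 - r, z0.1 + r]%classic : set R) `*` `[z0.2 - r, z0.2 + r]%classic).
split.
- by apply: measurableX; exact: measurable_itv.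
- suff -> : mu2 ((`[z0.1 - r, z0.1 + r]%classic : set R) `*`
               `[z0.2 - r, z0.2 + r]%classic) = ((2 * r)%:E * (2 * r)%:E)%E.
    by rewrite -EFinM lee_fin expr2.
  rewrite /mu2 product_measure1E; [|exact: measurable_itv..].
  exact: (f_equal2 mule (mI _) (mI _)).
- move=> z /=; rewrite prod_normE ge_max /= !ler_norml => /andP[h1 h2].
  split; rewrite /= in_itv /=; apply/andP; lra.
Qed.

(** Borel-Cantelli for outer measures: pass to measurable supersets. *)
Lemma limsup_null (A : nat -> set (R * R)) :
  (forall k, area_le (A k) (1 / (2 ^ k.+1)%:R)) -> lebesgue2_null (lim_sup_set A).
Proof.
move=> /choice[B HB].
have mB k : measurable (B k) by case: (HB k).
exists (lim_sup_set B); split.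
- apply: bigcap_measurable => // n _; apply: bigcup_measurable => // k _; exact: mB.
- apply: lim_sup_set_cvg0 => //.
  apply: (@le_lt_trans _ _ (\sum_(0 <= k <oo) (1 / (2 ^ k.+1)%:R : R)%:E)%E).
    by apply: lee_nneseries => // k _; case: (HB k).
  by apply: (le_lt_trans (epsilon_trick0 xpredT ler01)); rewrite ltry.
- move=> z Hz n _; have [k nk Ak] := Hz n I; exists k => //.
  by case: (HB k) => _ _; apply.
Qed.

End Covers.

(** * Countable unions of H^1-null sets *)

Section NullSets.
Variable R : realType.
Implicit Types (A B : set (R * R)).

Lemma ediam_ge0 A : (0 <= ediam A)%E.
Proof. by apply: ereal_sup_ubound; left. Qed.

Lemma hausdorff1_eq0P A : hausdorff1 A = 0%E <->
  forall d e : R, 0 < d -> 0 < e -> exists U : nat -> set (R * R),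
    [/\ A `<=` \bigcup_n U n, forall n, (ediam (U n) <= d%:E)%E &
        (\sum_(0 <= n <oo) ediam (U n) <= e%:E)%E].
Proof.
split=> [A0 d e d0 e0|H].
  have : (hausdorff1_delta d A < e%:E)%E.
    apply: (@le_lt_trans _ _ 0%E); last by rewrite lte_fin.
    by rewrite -A0; apply: ereal_sup_ubound; exists d.
  by move/ereal_inf_lt => [_ [U [AU Ud ->]] /ltW Ue]; exists U.
apply/eqP; rewrite eq_le; apply/andP; split.
  apply: ge_ereal_sup => _ [d /= d0 <-]; apply/lee_addgt0Pr => e e0; rewrite add0e.
  have [U [AU Ud Ue]] := H _ _ d0 e0.
  by apply: (le_trans _ Ue); apply: ereal_inf_lbound; exists U.
apply: (@le_trans _ _ (hausdorff1_delta 1 A)); last first.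
  by apply: ereal_sup_ubound; exists 1 => //=.
by apply: le_ereal_inf_tmp => _ [U [_ _ ->]]; apply: nneseries_ge0 => *; exact: ediam_ge0.
Qed.

Lemma hausdorff1_sub0 A B : A `<=` B -> hausdorff1 B = 0%E -> hausdorff1 A = 0%E.
Proof.
move=> AB /hausdorff1_eq0P B0; apply/hausdorff1_eq0P => d e d0 e0.
have [U [BU ? ?]] := B0 _ _ d0 e0; exists U; split => //.
exact: subset_trans BU.
Qed.

Lemma hausdorff1_bigcup0 (A : nat -> set (R * R)) :
  (forall n, hausdorff1 (A n) = 0%E) -> hausdorff1 (\bigcup_n A n) = 0%E.
Proof.
move=> A0; apply/hausdorff1_eq0P => d e d0 e0.
have /choice[U HU] : forall n, exists U : nat -> set (R * R),
    [/\ A n `<=` \bigcup_k U k, forall k, (ediam (U k) <= d%:E)%E &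
        (\sum_(0 <= k <oo) ediam (U k) <= (e / (2 ^ n.+1)%:R)%:E)%E].
  move=> n; have /hausdorff1_eq0P H := A0 n; apply: H => //.
  by rewrite divr_gt0 // ltr0n expn_gt0.
(* The covers of all the [A n] are listed as one sequence. *)
have /card_esym/ppcard_eqP[f] := card_nat2.
exists (fun m => U (f m).1 (f m).2); split.
- move=> x [n _ Ax]; have [/(_ x Ax)[k _ Uk] _ _] := HU n.
  by exists (f^-1%FUN (n, k)) => //=; rewrite invK ?inE.
- by move=> m; case: (HU (f m).1).
- rewrite nneseries_esumT; last by move=> *; exact: ediam_ge0.
  rewrite -(@reindex_esum R _ _ setT setT f (fun q => ediam (U q.1 q.2))); last first.
    exact: bij.
  have -> : [set: nat * nat] = [set k | setT k.1 /\ setT k.2] by apply/seteqP; split.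
  rewrite -(@esum_esum R _ _ setT (fun _ => setT) (fun i j => ediam (U i j)));
    last by move=> *; exact: ediam_ge0.
  apply: (le_trans _ (epsilon_trick0 xpredT (ltW e0))).
  rewrite -nneseries_esumT; last by move=> n; apply: esum_ge0 => *; exact: ediam_ge0.
  apply: lee_nneseries => [n _|n _].
    by move=> _; apply: esum_ge0 => *; exact: ediam_ge0.
  rewrite -nneseries_esumT; last by move=> *; exact: ediam_ge0.
  by case: (HU n).
Qed.

End NullSets.

(** * Area swept by a segment along a nearly parallel curve *)

Section Pieces.
Variable R : realType.
Implicit Types (p u v w z : R * R) (A G S : set (R * R)).

Definition cross v w : R := v.1 * w.2 - v.2 * w.1.
Definition dot v w : R := v.1 * w.1 + v.2 * w.2.

Definition sumset A G := [set z | exists p x, [/\ A p, G x & z = p + x]].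

Definition tube p w (eps : R) :=
    [set z | exists2 s : R, 0 <= s <= 1 & `|z - (p + s *: w)| < eps].

Lemma grid_cell (n : nat) (a b x : R) : (0 < n)%N -> a <= x <= b ->
  exists2 i, (i < n)%N & a + (b - a) / n%:R * i%:R <= x <= a + (b - a) / n%:R * i.+1%:R.
Proof.
move=> n0 /andP[ax xb].
have n0' : (0 < n%:R :> R) by rewrite ltr0n.
have H : forall k, (k <= n)%N -> x <= a + (b - a) / n%:R * k%:R ->
   (0 < k)%N -> exists2 i, (i < n)%N &
       a + (b - a) / n%:R * i%:R <= x <= a + (b - a) / n%:R * i.+1%:R.
  elim=> // j IHj jn xj _.
  case: (leP (a + (b - a) / n%:R * j%:R) x) => [jx|/ltW xj'].
    by exists j => //; apply/andP.
  case: j IHj jn xj xj' => [|j] IHj jn xj xj'; last by apply: IHj => //; exact: ltnW.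
  exists 0%N => //; rewrite xj andbT; lra.
apply: (H n) => //; rewrite divfK; [lra|by rewrite gt_eqF].
Qed.

Lemma normr_prod_le v (r : R) : `|v.1| <= r -> `|v.2| <= r -> `|v| <= r.
Proof. by rewrite prod_normE ge_max => -> ->. Qed.

Lemma norm_fst v : `|v.1| <= `|v|.
Proof. by rewrite prod_normE le_max lexx. Qed.

Lemma norm_snd v : `|v.2| <= `|v|.
Proof. by rewrite prod_normE le_max lexx orbT. Qed.

(** The set is a box of half-sides [4 d] and [3 e] with axis [u].  Squares of
half-side [4 e] centred on the axis at distance [e] from one another cover it,
and [9 d / e] of them suffice, each of area [64 e ^+ 2]. *)
Lemma area_le_box (u c : R * R) (d e : R) : u.1 ^+ 2 + u.2 ^+ 2 = 1 ->
  0 < e -> e <= d ->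
  area_le [set z | `|dot (z - c) u| <= 4 * d /\ `|cross (z - c) u| <= 3 * e]
      (576 * d * e).
Proof.
move=> u1 e0 ed.
have u1le : `|u.1| <= 1 by rewrite ler_norml; apply/andP; split; nra.
have u2le : `|u.2| <= 1 by rewrite ler_norml; apply/andP; split; nra.
set M := (Num.truncn (8 * d / e)).+1.
have d8 : 0 <= 8 * d / e by rewrite divr_ge0 //; lra.
have /andP[M1 M2] := truncn_itv d8.
have e0' : e != 0 by rewrite gt_eqF.
apply: (@area_le_sub _ _ [set z | exists2 i, (i < M)%N &
   [set z | `|z - (c + (i%:R * e - 4 * d) *: u)| <= 4 * e] z]
       (\sum_(i < M) (2 * (4 * e)) ^+ 2)).
- move=> z [/= h1 h2].
  have [i iM /andP[i1 i2]] : exists2 i, (i < M)%N &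
      i%:R * e <= dot (z - c) u + 4 * d <= (i%:R + 1) * e.
    have q0 : 0 <= (dot (z - c) u + 4 * d) / e.
      by rewrite divr_ge0 ?(ltW e0) //; move: h1; rewrite ler_norml => /andP[? ?]; lra.
    exists (Num.truncn ((dot (z - c) u + 4 * d) / e)).
      rewrite ltnS; apply: le_truncn; rewrite ler_pM2r ?invr_gt0 //.
      by move: h1; rewrite ler_norml => /andP[? ?]; lra.
    have /andP[t1 t2] := truncn_itv q0.
    rewrite -ler_pdivlMr // t1 /= -ler_pdivrMr //.
    by rewrite (le_trans (ltW t2)) // -natr1.
  exists i => //=.
  set D := dot (z - c) u in h1 i1 i2; set K := cross (z - c) u in h2.
  have E1 : (z - (c + (i%:R * e - 4 * d) *: u)).1 =
      (D - (i%:R * e - 4 * d)) * u.1 + K * u.2.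
    rewrite /D /K /dot /cross /= /GRing.scale /=.
    have -> : z.1 - (c.1 + (i%:R * e - 4 * d) * u.1) = (z.1 - c.1) * 1 -
        (i%:R * e - 4 * d) * u.1 by ring.
    by rewrite -u1; ring.
  have E2 : (z - (c + (i%:R * e - 4 * d) *: u)).2 =
      (D - (i%:R * e - 4 * d)) * u.2 - K * u.1.
    rewrite /D /K /dot /cross /= /GRing.scale /=.
    have -> : z.2 - (c.2 + (i%:R * e - 4 * d) * u.2) = (z.2 - c.2) * 1 -
        (i%:R * e - 4 * d) * u.2 by ring.
    by rewrite -u1; ring.
  have hD : `|D - (i%:R * e - 4 * d)| <= e by rewrite ler_norml; apply/andP; split; lra.
  have B (a b x y : R) : `|a| <= e -> `|b| <= 3 * e -> `|x| <= 1 -> `|y| <= 1 ->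
      `|a * x| + `|b * y| <= 4 * e.
    move=> ha hb hx hy; rewrite !normrM.
    have := ler_pM (normr_ge0 a) (normr_ge0 x) ha hx.
    have := ler_pM (normr_ge0 b) (normr_ge0 y) hb hy.
    lra.
  apply: normr_prod_le.
    by rewrite E1; apply: (le_trans (ler_normD _ _)); exact: B.
  by rewrite E2; apply: (le_trans (ler_normB _ _)); exact: B.
- rewrite sumr_const card_ord -[X in X <= _]mulr_natr.
  have hM : M%:R * e <= 9 * d.
    rewrite /M -natr1 mulrDl mul1r.
    have : (Num.truncn (8 * d / e))%:R * e <= 8 * d by rewrite -ler_pdivlMr.
    lra.
  have -> : (2 * (4 * e)) ^+ 2 * M%:R = 64 * e * (M%:R * e) by ring.
  have -> : 576 * d * e = 64 * e * (9 * d) by ring.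
  by rewrite ler_pM2l //; lra.
- apply: (@area_le_bigU _ M (fun i =>
    [set z | `|z - (c + (i%:R * e - 4 * d) *: u)| <= 4 * e])
     (fun=> (2 * (4 * e)) ^+ 2)) => i _.
  by apply: area_le_square; lra.
Qed.

(** A vector-valued mean value theorem, applied to the coordinates of [g] along
and across a direction. *)
Lemma mvt_lin (g : R -> R * R) (a b K s t : R) : s <= t ->
  (forall x, derivable g x 1) ->
  (forall x, s <= x <= t -> `|a * (g^`()%classic x).1 + b * (g^`()%classic x).2| <= K) ->
  `|a * (g t - g s).1 + b * (g t - g s).2| <= K * (t - s).
Proof.
move=> st dg HK.
have lc : continuous (fun v : R * R => a * v.1 + b * v.2).
  by move=> v; apply: cvgD; apply: cvgMl_tmp; [exact: cvg_fst|exact: cvg_snd].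
have dgl (x : R) : is_derive x (1 : R) (fun x : R => a * (g x).1 + b * (g x).2 : R)
     (a * (g^`()%classic x).1 + b * (g^`()%classic x).2).
  have L : h^-1 *: ((a * (g (h *: 1 + x)).1 + b * (g (h *: 1 + x)).2) -
      (a * (g x).1 + b * (g x).2))
     @[h --> 0^'] --> a * (g^`()%classic x).1 + b * (g^`()%classic x).2.
    have dgx : h^-1 *: (g (h *: 1 + x) - g x) @[h --> 0^'] --> g^`()%classic x.
      by rewrite derive1E; exact: dg.
    have -> : (fun h : R => h^-1 *:
        ((a * (g (h *: 1 + x)).1 + b * (g (h *: 1 + x)).2) - (a * (g x).1 + b * (g x).2)))
      = (fun v : R * R => a * v.1 + b * v.2) \o (fun h => h^-1 *: (g (h *: 1 + x) - g x)).
      by apply/funext => h /=; rewrite /GRing.scale /=; ring.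
    exact: (cvg_comp _ _ dgx (lc _)).
  by split; [apply/cvg_ex; eexists; exact: L|apply: cvg_lim => //; exact: L].
have cf : continuous (fun x => a * (g x).1 + b * (g x).2).
  move=> x; apply: differentiable_continuous; apply/derivable1_diffP.
  by case: (dgl x).
have [c cin E] := @MVT_segment R _ _ _ _ st (fun x _ => dgl x) (continuous_subspaceT cf).
have -> : a * (g t - g s).1 + b * (g t - g s).2 =
    (a * (g^`()%classic c).1 + b * (g^`()%classic c).2) * (t - s).
  by rewrite -E /=; ring.
rewrite normrM (ger0_norm (_ : 0 <= t - s)) ?subr_ge0 //.
rewrite ler_wpM2r ?subr_ge0 // HK //; move: cin; rewrite in_itv; exact.
Qed.

(** The bound is proportional to the transversality [om], to the length [d] of
the segment and to the parameter length of the curve.  Cut the curve into pieces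
of length at most [d]: the sum of the segment and of a piece lies in a box of
length comparable to [d] along [u] and of width comparable to [om] times the
parameter length of the piece.  For a segment much shorter than the curve,
this saves over a single box around the whole sum. *)
Lemma area_le_sweep (g : R -> R * R) u (s t V om d : R) :
  u.1 ^+ 2 + u.2 ^+ 2 = 1 -> s < t -> 0 < om -> om <= V -> 0 < d ->
  (forall x, derivable g x 1) ->
  (forall x, s <= x <= t -> `|dot (g^`()%classic x) u| <= V) ->
  (forall x, s <= x <= t -> `|cross (g^`()%classic x) u| <= om) ->
  exists2 eps : R, 0 < eps & forall p (x : R), `|x| <= d ->
    area_le (sumset (tube p (x *: u) eps) (g @` `[s, t]%classic))
        (576 * d * om * (t - s)).
Proof.
move=> u1 st om0 omV d0 dg HV Hom.
have u1le : `|u.1| <= 1 by rewrite ler_norml; apply/andP; split; nra.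
have u2le : `|u.2| <= 1 by rewrite ler_norml; apply/andP; split; nra.
have V0 : 0 < V by exact: lt_le_trans omV.
(* The curve is cut into [M] pieces of parameter length [h]. *)
set M := (Num.truncn (V * (t - s) / d)).+1.
have q0 : 0 <= V * (t - s) / d by rewrite divr_ge0 ?mulr_ge0 ?subr_ge0 //; exact: ltW.
have /andP[_ M2] := truncn_itv q0.
have M0 : 0 < M%:R :> R by rewrite ltr0n.
set h := (t - s) / M%:R.
have h0 : 0 < h by rewrite divr_gt0 // subr_gt0.
have Vh : V * h <= d.
  by rewrite /h mulrA ler_pdivrMr // [d * _]mulrC -ler_pdivrMr //; exact: ltW.
have hM : M%:R * h = t - s by rewrite /h mulrC divfK // gt_eqF.
have e0 : 0 < om * h by rewrite mulr_gt0.
have ed : om * h <= d by apply: (le_trans _ Vh); rewrite ler_pM2r.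
exists (om * h / 2); first by lra.
move=> p x xd.
pose tk (k : nat) := s + h * k%:R.
have tkS k : tk k.+1 = tk k + h by rewrite /tk -natr1; ring.
apply: (@area_le_sub _ _ [set z | exists2 k, (k < M)%N &
    `|dot (z - (p + g (tk k))) u| <= 4 * d /\ `|cross (z - (p + g (tk k))) u| <= 3 *
        (om * h)]
    (\sum_(k < M) (576 * d * (om * h)))).
- move=> z [q [y [[r /andP[r0 r1] qr] [T]]]] /=; rewrite in_itv /= => sTt yT zE.
  have [k kM kT] := @grid_cell M s t T (ltn0Sn _) sTt.
  have {}kT : tk k <= T <= tk k.+1 := kT.
  rewrite tkS in kT.
  have /andP[kT1 kT2] := kT.
  have skt : forall x, tk k <= x <= T -> s <= x <= t.
    move=> v /andP[kv vT]; have /andP[sT Tt] := sTt.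
    rewrite (le_trans vT) // andbT (le_trans _ kv) // /tk lerDl.
    by rewrite mulr_ge0 // ltW.
  exists k => //.
  set E := q - (p + r *: (x *: u)) in qr.
  have qr1 := le_lt_trans (norm_fst _) qr.
  have qr2 := le_lt_trans (norm_snd _) qr.
  set D := g T - g (tk k).
  have zE' : z - (p + g (tk k)) = (r * x) *: u + E + D.
    rewrite zE /E /D -yT -scalerA; set w := r *: _.
    by rewrite !opprD; apply/pair_equal_spec; split => /=; ring.
  have D1 : `|dot D u| <= V * h.
    have := @mvt_lin g u.1 u.2 V _ _ kT1 dg _.
    rewrite -/D => H; rewrite /dot mulrC [_ * u.2]mulrC; apply: (le_trans (H _)).
      by move=> v vk; have := HV v (skt v vk); rewrite /dot mulrC [_ * u.2]mulrC.
    by rewrite ler_pM2l //; lra.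
  have D2 : `|cross D u| <= om * h.
    have := @mvt_lin g u.2 (- u.1) om _ _ kT1 dg _.
    rewrite -/D => H.
    have cE v : cross v u = u.2 * v.1 + - u.1 * v.2 by rewrite /cross; ring.
    rewrite cE; apply: (le_trans (H _)).
      by move=> v vk; have := Hom v (skt v vk); rewrite cE.
    by rewrite ler_pM2l //; lra.
  have E3 : `|dot E u| <= om * h.
    rewrite /dot; apply: (le_trans (ler_normD _ _)); rewrite !normrM.
    have := ler_pM (normr_ge0 _) (normr_ge0 _) (ltW qr1) u1le.
    have := ler_pM (normr_ge0 _) (normr_ge0 _) (ltW qr2) u2le.
    lra.
  have E4 : `|cross E u| <= om * h.
    rewrite /cross; apply: (le_trans (ler_normB _ _)); rewrite !normrM.
    have := ler_pM (normr_ge0 _) (normr_ge0 _) (ltW qr1) u2le.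
    have := ler_pM (normr_ge0 _) (normr_ge0 _) (ltW qr2) u1le.
    lra.
  have rx : `|r * x| <= d.
    by rewrite normrM ger0_norm //; have := ler_pM r0 (normr_ge0 x) r1 xd; lra.
  rewrite zE'; split.
    have -> : dot ((r * x) *: u + E + D) u = r * x + dot E u + dot D u.
      by rewrite /dot /= /GRing.scale /= -[r * x in RHS]mulr1 -u1; ring.
    apply: (le_trans (ler_normD _ _)); have := ler_normD (r * x) (dot E u); lra.
  have -> : cross ((r * x) *: u + E + D) u = cross E u + cross D u.
    by rewrite /cross /= /GRing.scale /=; ring.
  apply: (le_trans (ler_normD _ _)); lra.
- rewrite sumr_const card_ord -[X in X <= _]mulr_natr.
  have -> : 576 * d * (om * h) * M%:R = 576 * d * om * (M%:R * h) by ring.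
  by rewrite hM lexx.
- apply: (@area_le_bigU _ M (fun k => [set z | `|dot (z - (p + g (tk k))) u| <= 4 * d /\
     `|cross (z - (p + g (tk k))) u| <= 3 * (om * h)]) (fun=> 576 * d * (om * h))) => k _.
  exact: area_le_box.
Qed.

End Pieces.

(** * Labelled paths replacing a segment *)

Section Replaceable.
Variable R : realType.
Implicit Types (p q u v w z : R * R) (S Gam : bool -> set (R * R)).

(** A time [x] has label [b] when a ball around [f x] is contained in [S x b].
The radius is the same for all times, so that labels survive small perturbations
of the path. *)
Definition labelled_path (S : R -> bool -> set (R * R)) p q (s t : R) :=
    exists (f : R -> R * R) (r : R),
  [/\ continuous f, f s = p, f t = q, 0 < r &
      forall x, s <= x <= t -> exists b, [set z | `|z - f x| < r] `<=` S x b].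

Lemma labelled_path_sub (S S' : R -> bool -> set (R * R)) p q s t :
  (forall x b, s <= x <= t -> S x b `<=` S' x b) ->
  labelled_path S p q s t -> labelled_path S' p q s t.
Proof.
move=> SS [f [r [cf fs ft r0 H]]]; exists f, r; split => // x xst; have [b Hb] := H x xst.
by exists b; apply: subset_trans (SS x b xst).
Qed.

(** Two paths meeting at time [m] are glued by a formula that is visibly
continuous: each is frozen at [m] outside its interval. *)
Lemma labelled_path_cat (S : R -> bool -> set (R * R)) p q q' s m t : s <= m -> m <= t ->
  labelled_path S p q s m -> labelled_path S q q' m t -> labelled_path S p q' s t.
Proof.
move=> sm mt [f [r [cf fs fm r0 Hf]]] [g [r' [cg gm gt r'0 Hg]]].
pose h x := f (Num.min x m) + (g (Num.max x m) - g m).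
have hl x : x <= m -> h x = f x.
  by move=> xm; rewrite /h min_l // max_r // subrr addr0.
have hr x : m <= x -> h x = g x.
  by move=> xm; rewrite /h min_r // max_l // fm gm addrC subrK.
exists h, (Num.min r r'); split.
- move=> x; apply: cvgD.
    apply: (@continuous_comp _ _ _ (fun x => Num.min x m) f); last exact: cf.
    by apply: continuous_min; [exact: cvg_id|exact: cvg_cst].
  apply: cvgB; last exact: cvg_cst.
  apply: (@continuous_comp _ _ _ (fun x => Num.max x m) g); last exact: cg.
  by apply: continuous_max; [exact: cvg_id|exact: cvg_cst].
- by rewrite hl.
- by rewrite hr.
- by rewrite lt_min r0.
- move=> x /andP[sx xt]; case: (leP x m) => [xm|/ltW mx].
    have [|b Hb] := Hf x; first by rewrite sx.
    exists b => z /=; rewrite hl // lt_min => /andP[zr _]; exact: Hb.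
  have [|b Hb] := Hg x; first by rewrite mx.
  exists b => z /=; rewrite hr // lt_min => /andP[_ zr]; exact: Hb.
Qed.

Lemma labelled_path_chain (n : nat) (q : nat -> R * R) (T : nat -> R)
    (S : nat -> bool -> set (R * R)) :
  (forall i, (i <= n)%N -> T i <= T i.+1) ->
  (forall i, (i <= n)%N -> labelled_path (fun=> S i) (q i) (q i.+1) (T i) (T i.+1)) ->
  labelled_path (fun x b => [set z | exists i,
      [/\ (i <= n)%N, T i <= x <= T i.+1 & S i b z]]) (q 0%N) (q n.+1) (T 0%N) (T n.+1).
Proof.
elim: n => [|n IH] hT H.
  by apply: labelled_path_sub (H 0%N _) => // x b xT z Sz; exists 0%N.
apply: (@labelled_path_cat _ _ (q n.+1) _ _ (T n.+1)).
- have {IH H} : forall i, (i <= n.+1)%N -> T 0%N <= T i.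
    by elim=> // i IHi ?; apply: (le_trans (IHi _) (hT _ _)); exact: ltnW.
  exact.
- exact: hT.
- apply: labelled_path_sub (IH _ _) => [x b _ z [i [ilen iT Sz]]|i ilen|i ilen].
  + by exists i; split => //; exact: leqW.
  + by apply: hT; exact: leqW.
  + by apply: H; exact: leqW.
- by apply: labelled_path_sub (H n.+1 _) => // x b xT z Sz; exists n.+1.
Qed.

Lemma labelled_path_segment S b p w s t r : s < t -> 0 < r -> tube p w r `<=` S b ->
  labelled_path (fun=> S) p (p + w) s t.
Proof.
move=> st r0 HS; exists (fun x => p + ((x - s) / (t - s)) *: w), r; split => //.
- move=> x; apply: cvgD; first exact: cvg_cst.
  apply: cvgZr_tmp; apply: cvgMr_tmp; apply: cvgB; [exact: cvg_id|exact: cvg_cst].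
- by rewrite subrr mul0r scale0r addr0.
- by rewrite divff ?scale1r // subr_eq0 gt_eqF.
- move=> x /andP[sx xt]; exists b => z zr; apply: HS; exists ((x - s) / (t - s)) => //.
  by rewrite divr_ge0 ?subr_ge0 ?(ltW st) //= ler_pdivrMr ?subr_gt0 // mul1r lerD2r.
Qed.

Definition sumset2 S Gam := [set z | exists b, sumset (S b) (Gam b) z].

(** The segment from [p] to [p + w] can be replaced, in any neighbourhood of
itself, by a labelled path for which the points labelled [b] sweep along
[Gam b], for both labels together, an outer area arbitrarily close to [c]. *)
Definition replaceable Gam w (c : R) := forall p s t eps tau,
  s < t -> 0 < eps -> 0 < tau -> exists S,
  [/\ labelled_path (fun=> S) p (p + w) s t, forall b, S b `<=` tube p w eps &
      area_le (sumset2 S Gam) (c + tau)].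

Lemma replaceable_le Gam w c c' : c <= c' -> replaceable Gam w c -> replaceable Gam w c'.
Proof.
move=> cc' H p s t eps tau st e0 t0; have [S [H1 H2 H3]] := H p s t eps tau st e0 t0.
by exists S; split => //; apply: area_le_sub H3 => //; rewrite lerD2r.
Qed.

(** When nothing is left to sweep for the label [b], the whole segment takes this
label. *)
Lemma replaceable_done Gam w b : Gam b = set0 -> replaceable Gam w 0.
Proof.
move=> G0 p s t eps tau st e0 t0.
exists (fun b' => if b' == b then tube p w eps else set0); split.
- by apply: (labelled_path_segment (b := b) (r := eps)) => //; rewrite eqxx.
- by move=> b' z; case: ifP.
- apply: (@area_le_sub _ _ set0 0 _) => //; last exact: area_le0.
    by move=> z [b' [x [y [+ + _]]]]; case: ifP => [/eqP ->|//]; rewrite G0.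
  by rewrite add0r ltW.
Qed.

(** Adding to the curves a part [H] along which the segment itself sweeps an area
[d] costs only [d], however long the replacing path is: that path can be kept in
the neighbourhood of the segment for which the area [d] has been paid. *)
Lemma replaceable_add Gam Gam' H w c d :
  (forall b z, Gam b z -> Gam' b z \/ H z) ->
  (forall tau : R, 0 < tau -> exists2 eps, 0 < eps & forall p,
      area_le (sumset (tube p w eps) H) (d + tau)) ->
  replaceable Gam' w c -> replaceable Gam w (c + d).
Proof.
move=> GG HH HR p s t eps tau st e0 t0.
have t2 : 0 < tau / 2 by lra.
have [e' e'0 He'] := HH _ t2.
have [|S [H1 H2 H3]] := HR p s t (Num.min eps e') (tau / 2) st _ t2.
  by rewrite lt_min e0.
exists S; split => //.
  by move=> b z /H2 [r r01]; rewrite lt_min => /andP[zr _]; exists r.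
apply: (area_le_sub _ _ (area_leU H3 (He' p))); last by lra.
move=> z [b [x [y [Sx /GG[Gy|Hy] ->]]]]; first by left; exists b, x, y.
right; exists x, y; split => //; have [r r01] := H2 _ _ Sx.
by rewrite lt_min => /andP[_ zr]; exists r.
Qed.

(** A zigzag with sufficiently many teeth parallel to [v1] and [v2] stays close to
the segment [v1 + v2]; its teeth are then replaced one by one. *)
Lemma replaceable_zigzag Gam v1 v2 c1 c2 :
  (forall N, (0 < N)%N -> replaceable Gam (N%:R^-1 *: v1) (N%:R^-1 * c1)) ->
  (forall N, (0 < N)%N -> replaceable Gam (N%:R^-1 *: v2) (N%:R^-1 * c2)) ->
  replaceable Gam (v1 + v2) (c1 + c2).
Proof.
move=> H1 H2 p s t eps tau st e0 t0.
set w := v1 + v2.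
(* [N] teeth, each of size less than [eps / 2]. *)
pose N := (Num.truncn ((`|v1| + `|v2|) / (eps / 2))).+1.
have q0 : 0 <= (`|v1| + `|v2|) / (eps / 2) by rewrite divr_ge0 ?addr_ge0 //; lra.
have /andP[_ M2] := truncn_itv q0.
have N0 : 0 < N%:R :> R by rewrite ltr0n.
have N0' : N%:R != 0 :> R by rewrite gt_eqF.
have {}H1 := H1 N (ltn0Sn _); have {}H2 := H2 N (ltn0Sn _).
set n := N%:R^-1 : R in H1 H2 *.
have n0 : 0 < n by rewrite invr_gt0.
have nN : n * N%:R = 1 by rewrite mulVf.
have small : n * `|v1| + n * `|v2| < eps / 2.
  rewrite -mulrDr mulrC ltr_pdivrMr // mulrC -ltr_pdivrMr //; lra.
pose q i := p + (n * i%:R) *: w.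
pose T i := s + (t - s) * (n * i%:R).
have TS i : T i.+1 = T i + (t - s) * n by rewrite /T -natr1; ring.
have ts0 : 0 < (t - s) * n by rewrite mulr_gt0 // subr_gt0.
have subD (a b c : R * R) : a - b = a - (b + c) + c by rewrite opprD addrA subrK.
have tooth i : (i < N)%N -> exists S,
  [/\ labelled_path (fun=> S) (q i) (q i.+1) (T i) (T i.+1),
      forall b, S b `<=` tube p w eps &
      area_le (sumset2 S Gam) (n * (c1 + c2) + n * tau)].
  move=> iN.
  have nt : 0 < n * tau / 2 by rewrite divr_gt0 // mulr_gt0.
  have e2 : 0 < eps / 2 by lra.
  have l1 : T i < T i + (t - s) * n / 2 by lra.
  have l2 : T i + (t - s) * n / 2 < T i.+1 by rewrite TS; lra.
  have [S1 [P1 N1 C1]] := H1 (q i) _ _ _ _ l1 e2 nt.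
  have [S2 [P2 N2 C2]] := H2 (q i + n *: v1) _ _ _ _ l2 e2 nt.
  have ni01 : 0 <= n * i%:R <= 1.
    rewrite mulr_ge0 ?(ltW n0) //= -[X in _ <= X]nN ler_pM2l // ler_nat; exact: ltnW.
  exists (fun b => S1 b `|` S2 b); split.
  - have -> : q i.+1 = q i + n *: v1 + n *: v2.
      by rewrite -addrA -scalerDr /q -natr1 mulrDr mulr1 scalerDl addrA.
    apply: (labelled_path_cat (ltW l1) (ltW l2)).
      by apply: labelled_path_sub P1 => _ b _ z ?; left.
    by apply: labelled_path_sub P2 => _ b _ z ?; right.
  - move=> b z [/N1|/N2] [r /andP[r0 r1] zr]; exists (n * i%:R) => //; rewrite -/(q i).
      have -> : z - q i = (z - (q i + r *: (n *: v1))) + r *: (n *: v1).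
        exact: subD.
      apply: (le_lt_trans (ler_normD _ _)); rewrite !normrZ (ger0_norm r0) (gtr0_norm n0).
      have h0 : 0 <= n * `|v1| by rewrite mulr_ge0 // ltW.
      have h1 : 0 <= n * `|v2| by rewrite mulr_ge0 // ltW.
      have := ler_wpM2r h0 r1; lra.
    have -> : z - q i = (z - (q i + n *: v1 + r *: (n *: v2))) +
        (n *: v1 + r *: (n *: v2)).
      by rewrite -[q i + _ + _]addrA; exact: subD.
    apply: (le_lt_trans (ler_normD _ _)).
    have := ler_normD (n *: v1) (r *: (n *: v2)).
    rewrite !normrZ (ger0_norm r0) (gtr0_norm n0).
    have h1 : 0 <= n * `|v2| by rewrite mulr_ge0 // ltW.
    have := ler_wpM2r h1 r1; lra.
  - apply: (area_le_sub _ _ (area_leU C1 C2)); last by lra.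
    move=> z [b [x [y [[Sx|Sx] Gy ->]]]]; [left|right]; by exists b, x, y.
have /choice[S HS] : forall i, exists S, (i < N)%N ->
  [/\ labelled_path (fun=> S) (q i) (q i.+1) (T i) (T i.+1),
      forall b, S b `<=` tube p w eps &
      area_le (sumset2 S Gam) (n * (c1 + c2) + n * tau)].
  by move=> i; case: (ltnP i N) => [/tooth[S ?]|_]; [exists S|exists (fun=> set0)].
exists (fun b => [set z | exists2 i, (i < N)%N & S i b z]); split.
- have q0E : q 0%N = p by rewrite /q mulr0 scale0r addr0.
  have qNE : q N = p + w by rewrite /q nN scale1r.
  have T0E : T 0%N = s by rewrite /T !mulr0 addr0.
  have TNE : T N = t by rewrite /T nN mulr1 addrC subrK.
  rewrite -qNE -TNE -q0E -T0E.
  apply: labelled_path_sub (@labelled_path_chain N.-1 q T S _ _) =>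
      [x b _ z [i [iN _ Sz]]|i iN|i iN].
    by exists i.
    by rewrite TS; lra.
  by case: (HS i iN).
- by move=> b z [i iN]; case: (HS i iN) => _ h _; exact: h.
- apply: (@area_le_sub _ _ [set z | exists2 i, (i < N)%N & sumset2 (S i) Gam z]
     (\sum_(i < N) (n * (c1 + c2) + n * tau))).
  + by move=> z [b [x [y [[i iN Sx] Gy ->]]]]; exists i => //; exists b, x, y.
  + rewrite sumr_const card_ord -[X in X <= _]mulr_natr.
    have -> : (n * (c1 + c2) + n * tau) * N%:R = (n * N%:R) * (c1 + c2 + tau) by ring.
    by rewrite nN mul1r.
  + apply: (@area_le_bigU _ N (fun i => sumset2 (S i) Gam)
      (fun=> n * (c1 + c2) + n * tau)) => i iN.
    by case: (HS i iN).
Qed.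

End Replaceable.

(** * Turning through a grid of directions *)

(** [u b i] are the grid directions of the arc [b], [G b i] is the part of the
curves whose direction lies in the [i]-th small arc of [b], and [l b i] is its
length.  Hypothesis [turn] is the transversality of the two arcs. *)
Section Tree.
Variable R : realType.
Variables (n : nat) (u : bool -> nat -> R * R) (G : bool -> nat -> set (R * R)).
Variables (l : bool -> nat -> R) (kappa rho : R).
Hypothesis l_ge0 : forall b i, 0 <= l b i.
Hypothesis kappa_ge0 : 0 <= kappa.
Hypothesis rho_ge0 : 0 <= rho.
Hypothesis sweepG : forall b i, (i < n)%N -> forall x tau : R, 0 < tau ->
  exists2 eps, 0 < eps &
    forall p, area_le (sumset (tube p (x *: u b i) eps) (G b i))
        (`|x| * (kappa * l b i) + tau).
Hypothesis turn : forall b i j, (i < n)%N -> (j <= n)%N -> exists X Y : R,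
  u b i = X *: u b i.+1 + Y *: u (~~ b) j /\ `|X| + `|Y| <= 1 + rho.

Let Gam (k : bool -> nat) b := [set z | exists i, [/\ (k b <= i)%N, (i < n)%N & G b i z]].
Let L (k : bool -> nat) := \sum_b \sum_(k b <= i < n) l b i.

(** The state [k] records how many small arcs of each arc have been used up; the
segment points in the first unused direction of the arc [b].  The induction pays
for the part [G b (k b)] and turns the segment into a zigzag whose two sides
are again segments of this kind, for the state with one more small arc of [b]
used up.  The cost [L k] is additive in the parts, and therefore each part is
counted once, whatever the branch on which it is used up; only the total length
grows, by [1 + rho] per turn. *)
Lemma replaceable_grid m k b x : (forall b, (k b <= n)%N) ->
  ((n - k true) + (n - k false) = m)%N ->
  replaceable (Gam k) (x *: u b (k b)) (`|x| * (kappa * ((1 + rho) ^+ m * L k))).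
Proof.
have L0 k' : 0 <= L k' by apply: sumr_ge0 => b' _; apply: sumr_ge0.
have r1 : 1 <= 1 + rho by rewrite lerDl.
elim: m k b x => [|m IH] k b x kn km.
  apply: (@replaceable_le _ _ _ 0); last first.
    apply: (@replaceable_done _ _ _ b); rewrite -subset0 => z [i [ki ilt _]].
    have := leq_ltn_trans ki ilt; move/eqP: km; rewrite addn_eq0 !subn_eq0 =>
        /andP[h1 h2].
    by case: b ki => ki; rewrite ltnNge ?h1 ?h2.
  by rewrite mulr_ge0 // mulr_ge0 // mulr_ge0 // exprn_ge0 // (le_trans ler01).
have [kb|kb] := eqVneq (k b) n.
  apply: (@replaceable_le _ _ _ 0); last first.
    apply: (@replaceable_done _ _ _ b); rewrite -subset0 => z [i [ki ilt _]].
    by have := leq_ltn_trans ki ilt; rewrite kb ltnn.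
  by rewrite mulr_ge0 // mulr_ge0 // mulr_ge0 // exprn_ge0 // (le_trans ler01).
have {}kb : (k b < n)%N by rewrite ltn_neqAle kb kn.
pose k' b' := if b' == b then (k b).+1 else k b'.
have k'n b' : (k' b' <= n)%N by rewrite /k'; case: eqP => // _.
have k'm : ((n - k' true) + (n - k' false) = m)%N.
  rewrite /k'; case: b kb k' k'n => kb k' k'n /=.
    by apply: succn_inj; rewrite -km -addSn subnSK.
  by apply: succn_inj; rewrite -km -addnS subnSK.
have LE : L k = l b (k b) + L k'.
  rewrite /L !big_bool /k'; case: b kb k' k'n k'm => kb k' k'n k'm /=.
    by rewrite big_ltn // addrA.
  by rewrite [X in _ + X]big_ltn // addrCA.
have [X [Y [uE XY]]] := turn b kb (kn (~~ b)).
have k'b : k' b = (k b).+1 by rewrite /k' eqxx.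
have k'nb : k' (~~ b) = k (~~ b) by rewrite /k'; case: (b).
set C := kappa * ((1 + rho) ^+ m * L k').
have C0 : 0 <= C.
  by rewrite mulr_ge0 // mulr_ge0 // exprn_ge0 // (le_trans ler01).
have zz : replaceable (Gam k') (x *: u b (k b)) (`|x * X| * C + `|x * Y| * C).
  have -> : x *: u b (k b) = (x * X) *: u b (k b).+1 + (x * Y) *: u (~~ b) (k (~~ b)).
    by rewrite uE scalerDr !scalerA.
  have nE N y : (0 < N)%N -> N%:R^-1 * (`|y| * C) = `|N%:R^-1 * y| * C.
    by move=> N0; rewrite normrM ger0_norm ?invr_ge0 // mulrA.
  apply: replaceable_zigzag => N N0.
    rewrite scalerA nE //; have := IH k' b (N%:R^-1 * (x * X)) k'n k'm.
    by rewrite k'b.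
  rewrite scalerA nE //; have := IH k' (~~ b) (N%:R^-1 * (x * Y)) k'n k'm.
  by rewrite k'nb.
apply: replaceable_le (replaceable_add (H := G b (k b))
    (d := `|x| * (kappa * l b (k b))) _ _ zz); last 2 first.
- move=> b' z [i [ki ilt Gi]]; rewrite /Gam /k' /=; case: eqP => [E|_]; last by left;
    exists i.
  subst b'; move: ki; rewrite leq_eqVlt => /predU1P[ki|ki]; first by right; rewrite ki.
  by left; exists i.
- by move=> tau t0; exact: sweepG.
have -> : `|x * X| * C + `|x * Y| * C + `|x| * (kappa * l b (k b)) =
    `|x| * ((`|X| + `|Y|) * C + kappa * l b (k b)) by rewrite !normrM; ring.
rewrite ler_wpM2l //.
rewrite LE.
have h1 : (`|X| + `|Y|) * C <= (1 + rho) * C by rewrite ler_wpM2r.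
have h2 : kappa * l b (k b) <= (1 + rho) ^+ m.+1 * (kappa * l b (k b)).
  by rewrite ler_peMl ?mulr_ge0 // exprn_ege1.
have -> : kappa * ((1 + rho) ^+ m.+1 * (l b (k b) + L k')) =
  (1 + rho) * C + (1 + rho) ^+ m.+1 * (kappa * l b (k b)).
  by rewrite /C exprS; ring.
lra.
Qed.

End Tree.

(** * Uniform bounds, unit vectors, and sweeping costs *)

Section Angles.
Variable R : realType.

Lemma heine (f : R -> R * R) (a b e : R) : continuous f -> 0 < e ->
  exists2 d, 0 < d & forall x y, a <= x <= b -> `|x - y| < d -> `|f x - f y| < e.
Proof.
move=> cf e0.
have /compact_near_coveringP nc := @segment_compact R a b.
pose P (d x : R) := forall y, `|x - y| < d -> `|f x - f y| < e.
have e2 : 0 < e / 2 by lra.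
have near0 : \forall d \near (0 : R)^'+, `[a, b]%classic `<=` P d.
  apply: nc => x _.
  have /cvgrPdist_lt/(_ _ e2)/nbhs_ballP[d /= d0 Hd] := cf x.
  have d2 : 0 < d / 2 by lra.
  exists (ball x (d / 2), [set z : R | z < d / 2]) => /=.
    by split; [exact: nbhsx_ballx|exact: nbhs_right_lt].
  move=> [x' d'] /= [xx' dd'] y xy.
  have h1 : `|f x - f x'| < e / 2.
    by apply: Hd; apply: le_ball xx'; lra.
  have h2 : `|f x - f y| < e / 2.
    apply: Hd; rewrite /ball /=; have := ler_distD x' x y.
    by move: xx'; rewrite /ball /=; lra.
  have := ler_distD (f x) (f x') (f y); rewrite (distrC (f x') (f x)); lra.
have /filter_ex[d [d0 Hd]] : \forall d \near (0 : R)^'+,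
    0 < d /\ `[a, b]%classic `<=` P d.
  by apply: filterI => //; exact: nbhs_right_gt.
by exists d => // x y xab; apply: Hd; rewrite /= in_itv.
Qed.

Lemma sin_lip (x y : R) : `|sin x - sin y| <= `|x - y|.
Proof.
wlog xy : x y / x <= y.
  by move=> H; case: (leP x y) => [/H //|/ltW/H]; rewrite distrC (distrC y).
have cs : {within `[x, y], continuous (@sin R)}.
  by apply: continuous_subspaceT => z; exact: continuous_sin.
have [c _ E] := @MVT_segment R _ _ _ _ xy (fun z _ => is_derive_sin z) cs.
rewrite distrC E normrM distrC ler_piMl //; exact: cos_max.
Qed.

Lemma sin_lbound (a b : R) : 0 < a -> a <= b -> b < pi ->
  exists2 c : R, 0 < c & forall x, a <= x <= b -> c <= sin x.
Proof.
move=> a0 ab bpi.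
have cs : {within `[a, b], continuous (@sin R)}.
  by apply: continuous_subspaceT => z; exact: continuous_sin.
have [c + H] := EVT_min ab cs; rewrite in_itv /= => /andP[ac cb].
exists (sin c) => [|x xab]; last by apply: H; rewrite in_itv.
by apply: sin_gt0_pi; rewrite (lt_le_trans a0) //= (le_lt_trans cb).
Qed.

Lemma bounded_on_segment (f : R -> R * R) (a b : R) : continuous f ->
  exists2 V, 0 < V & forall x, a <= x <= b -> `|f x| <= V.
Proof.
move=> cf; case: (leP a b) => [ab|ba]; last first.
  by exists 1 => // x /andP[ax xb]; have := le_trans ax xb; rewrite leNgt ba.
have cs : {within `[a, b], continuous (fun x => `|f x| : R)}.
  by apply: continuous_subspaceT => z; apply: cvg_norm; exact: cf.
have [c _ H] := EVT_max ab cs.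
exists (`|f c| + 1) => [|x xab]; first by rewrite ltr_pwDr.
by rewrite (le_trans (H x _)) ?in_itv // lerDl.
Qed.

Definition dirv (al : R) : R * R := (cos al, sin al).

Lemma cross_dirv (al be : R) : cross (dirv al) (dirv be) = sin (be - al).
Proof. by rewrite sinB /cross /=; ring. Qed.

Lemma crossBl (v w u : R * R) : cross (v - w) u = cross v u - cross w u.
Proof. by rewrite /cross /=; ring. Qed.

Lemma crossZl (r : R) (v u : R * R) : cross (r *: v) u = r * cross v u.
Proof. by rewrite /cross /= /GRing.scale /=; ring. Qed.

Lemma norm_dirv (al : R) : (dirv al).1 ^+ 2 + (dirv al).2 ^+ 2 = 1.
Proof. exact: cos2Dsin2. Qed.

(** A segment of length [|x|] in the direction [u], together with a neighbourhood
of it that may depend on [x], sweeps along [G] an area of at most [c] times its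
length, up to an arbitrarily small error.  The error term makes the bound
meaningful for [x = 0]. *)
Definition sweep_cost (u : R * R) (G : set (R * R)) (c : R) :=
  forall x tau : R, 0 < tau -> exists2 eps, 0 < eps &
    forall p, area_le (sumset (tube p (x *: u) eps) G) (`|x| * c + tau).

Lemma sweep_cost0 u c : 0 <= c -> sweep_cost u set0 c.
Proof.
move=> c0 x tau t0; exists 1 => // p; apply: (@area_le_sub _ _ set0 0) => //.
- by move=> z [? [? []]].
- by rewrite addr_ge0 ?mulr_ge0 // ltW.
- exact: area_le0.
Qed.

Lemma sweep_costU u G G' c c' : sweep_cost u G c -> sweep_cost u G' c' ->
  sweep_cost u (G `|` G') (c + c').
Proof.
move=> k k' x tau t0; have t2 : 0 < tau / 2 by lra.
have [e e0 H] := k x _ t2; have [e' e'0 H'] := k' x _ t2.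
exists (Num.min e e') => [|p]; first by rewrite lt_min e0.
apply: (area_le_sub _ _ (area_leU (H p) (H' p))); last by rewrite mulrDr; lra.
move=> z [y [y' [[r r01]]]]; rewrite lt_min => /andP[h1 h2] [Gy|Gy] ->; [left|right].
  by exists y, y'; split => //; exists r.
by exists y, y'; split => //; exists r.
Qed.

Lemma sweep_cost_sub u G G' c c' : G `<=` G' -> c' <= c -> sweep_cost u G' c' ->
    sweep_cost u G c.
Proof.
move=> GG cc k x tau t0; have [e e0 H] := k x _ t0; exists e => // p.
apply: (area_le_sub _ _ (H p)); last by rewrite lerD2r ler_wpM2l.
by move=> z [y [y' [? ? ?]]]; exists y, y'; split => //; exact: GG.
Qed.

Lemma sweep_cost_bigU u (n : nat) (P : pred nat) (G : nat -> set (R * R)) (c : nat -> R) :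
  (forall i, (i < n)%N -> P i -> sweep_cost u (G i) (c i)) ->
  sweep_cost u [set z | exists i, [/\ (i < n)%N, P i & G i z]] (\sum_(i < n | P i) c i).
Proof.
elim: n => [_|n IH H].
  rewrite big_ord0; apply: sweep_cost_sub (sweep_cost0 u (lexx 0)) => // z [i []] //.
rewrite big_mkcond big_ord_recr -big_mkcond /=.
have h := IH (fun i ilt => H i (leqW ilt)).
case: ifPn => [Pn|Pn].
  apply: sweep_cost_sub (sweep_costU h (H n (ltnSn _) Pn)) => // z [i [+ Pi Gi]].
  by rewrite ltnS leq_eqVlt => /predU1P[<-|ilt]; [right|left; exists i].
rewrite addr0; apply: sweep_cost_sub h => // z [i [+ Pi Gi]].
rewrite ltnS leq_eqVlt => /predU1P[E|ilt]; last by exists i.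
by move: Pn; rewrite -E Pi.
Qed.

Lemma sweep_cost_curve (g : R -> R * R) u (s t V om : R) :
  u.1 ^+ 2 + u.2 ^+ 2 = 1 -> s < t -> 0 < om ->
  (forall x, derivable g x 1) ->
  (forall x, s <= x <= t -> `|dot (g^`()%classic x) u| <= V) ->
  (forall x, s <= x <= t -> `|cross (g^`()%classic x) u| <= om) ->
  sweep_cost u (g @` `[s, t]%classic) (576 * om * (t - s)).
Proof.
move=> u1 st om0 dg HV Hom x tau t0.
have B0 : 0 < 576 * om * (t - s).
  by apply: mulr_gt0; [apply: mulr_gt0; [rewrite ltr0n|]|rewrite subr_gt0].
set B := 576 * om * (t - s) in B0 *.
(* Lengthening the segment by [tau / B] costs exactly [tau]. *)
pose d := `|x| + tau / B.
have d0 : 0 < d by rewrite ltr_wpDl // divr_gt0.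
have [||eps e0 H] := @area_le_sweep R g u s t (V + om) om d u1 st om0 _ d0 dg _ Hom.
- by rewrite lerDr; apply: le_trans (HV s _) => //; rewrite lexx ltW.
- by move=> y /HV h; rewrite (le_trans h) // lerDl ltW.
exists eps => // p.
have xd : `|x| <= d by rewrite lerDl divr_ge0 // ltW.
apply: (area_le_sub _ _ (H p x xd)) => //.
have -> : 576 * d * om * (t - s) = d * B by rewrite /B; ring.
by rewrite mulrDl divfK // gt_eqF.
Qed.

End Angles.

(** * Sorting the pieces of a curve by direction *)

Section SplitCurve.
Variable R : realType.

(** The curve is cut into pieces on which the derivative varies by less than
[eta].  A piece having somewhere a direction in the [j]-th small arc of
[[lo, hi]], with one such [j] chosen for each piece, is put into [G j]; all of
it is then nearly parallel to the [j]-th grid direction.  As each piece is used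
only once, the lengths [l j] add up to at most the length of the whole
interval. *)
Lemma split_by_direction (g : R -> R * R) (a b V lo hi eta : R) (n : nat) :
  a < b -> (forall x, derivable g x 1) -> continuous g^`()%classic ->
  (forall x, a <= x <= b -> `|g^`()%classic x| <= V) -> 0 < V ->
  (0 < n)%N -> 0 < eta -> (hi - lo) / n%:R <= eta ->
  exists (G : nat -> set (R * R)) (l : nat -> R),
    [/\ forall j, (j < n)%N -> sweep_cost (dirv (lo + (hi - lo) / n%:R * j%:R)) (G j)
          (576 * ((2 * V + 2) * eta) * l j),
        forall j, 0 <= l j, \sum_(j < n) l j <= b - a &
        forall t r al, a <= t <= b -> lo <= al <= hi -> g^`()%classic t = r *: dirv al ->
          exists2 j, (j < n)%N & G j (g t)].
Proof.
move=> ab dg cg HV V0 n0 eta0 Heta.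
pose th j := lo + (hi - lo) / n%:R * j%:R.
have [d d0 Hd] := heine a b cg eta0.
pose M := (Num.truncn ((b - a) / d)).+1.
have /andP[_ M2] : (Num.truncn ((b - a) / d))%:R <= (b - a) / d < M%:R.
  by apply: truncn_itv; rewrite divr_ge0 // ltW // subr_gt0.
have M0 : 0 < M%:R :> R by rewrite ltr0n.
set h := (b - a) / M%:R.
have h0 : 0 < h by rewrite divr_gt0 // subr_gt0.
have hd : h < d by rewrite ltr_pdivrMr // mulrC -ltr_pdivrMr.
have hM : h * M%:R = b - a by rewrite divfK // gt_eqF.
pose c m := a + h * m%:R.
have cS m : c m.+1 = c m + h by rewrite /c -natr1; ring.
have cin m x : (m < M)%N -> c m <= x <= c m.+1 -> a <= x <= b.
  move=> mM /andP[x1 x2].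
  have h1 : a <= c m by rewrite lerDl mulr_ge0 // ltW.
  have h2 : c m.+1 <= b by rewrite /c -lerBrDl -hM ler_pM2l // ler_nat.
  by rewrite (le_trans h1) // (le_trans x2).
pose good m j := exists t r al, [/\ c m <= t <= c m.+1, g^`()%classic t = r *: dirv al &
  th j <= al <= th j.+1].
(* [A m] is the small arc chosen for the [m]-th piece, and [n] if there is none. *)
have /choice[A HA] : forall m, exists j, ((j < n)%N -> good m j) /\
   (forall t r al, c m <= t <= c m.+1 -> lo <= al <= hi ->
       g^`()%classic t = r *: dirv al -> (j < n)%N).
  move=> m; have [[j jn gj]|H] := pselect (exists2 j, (j < n)%N & good m j);
      first by exists j.
  exists n; split; first by rewrite ltnn.
  move=> t r al tc lal gt; have [j jn jal] := grid_cell n0 lal.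
  by case: H; exists j => //; exists t, r, al.
pose G j := [set z | exists m, [/\ (m < M)%N, A m == j &
    (g @` `[c m, c m.+1]%classic) z]].
exists G, (fun j => \sum_(m < M | A m == j) h); split.
- move=> j jn; rewrite mulr_sumr.
  apply: (@sweep_cost_bigU _ _ M (fun m => A m == j)
      (fun m => g @` `[c m, c m.+1]%classic)
     (fun=> 576 * ((2 * V + 2) * eta) * h)) => m mM /eqP Am.
  have om0 : 0 < (2 * V + 2) * eta by rewrite mulr_gt0 //; lra.
  have hE : h = c m.+1 - c m by rewrite cS addrAC subrr add0r.
  have [+ _] := HA m; rewrite Am => /(_ jn) [t [r [al [tc gt /andP[al1 al2]]]]].
  rewrite hE; apply: (@sweep_cost_curve _ _ _ _ _ (2 * V)) => //.
  + exact: norm_dirv.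
  + by rewrite cS ltrDl.
  + move=> x /(cin _ _ mM)/HV gx; rewrite /dot /=.
    apply: (le_trans (ler_normD _ _)); rewrite !normrM.
    have := ler_pM (normr_ge0 _) (normr_ge0 _) (le_trans (norm_fst _) gx)
        (cos_max (th j)).
    have := ler_pM (normr_ge0 _) (normr_ge0 _) (le_trans (norm_snd _) gx)
        (sin_max (th j)).
    rewrite -/(th j); lra.
  + move=> x xc.
    have r2V : `|r| <= 2 * V.
      have -> : r = dot (g^`()%classic t) (dirv al).
        by rewrite gt /dot /= /GRing.scale /= -[LHS]mulr1 -(norm_dirv al) /=; ring.
      have gx := HV t (cin _ _ mM tc); rewrite /dot /=.
      apply: (le_trans (ler_normD _ _)); rewrite !normrM.
      have := ler_pM (normr_ge0 _) (normr_ge0 _) (le_trans (norm_fst _) gx) (cos_max al).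
      have := ler_pM (normr_ge0 _) (normr_ge0 _) (le_trans (norm_snd _) gx) (sin_max al).
      lra.
    have c1 : `|cross (g^`()%classic t) (dirv (th j))| <= 2 * V * eta.
      have -> : cross (g^`()%classic t) (dirv (th j)) = r * sin (th j - al).
        by rewrite gt crossZl cross_dirv.
      rewrite normrM; apply: ler_pM => //.
      have := sin_lip (th j - al) 0; rewrite sin0 !subr0 => /le_trans; apply.
      rewrite distrC ger0_norm ?subr_ge0 // (le_trans _ Heta) //.
      by move: al2; rewrite /th -natr1; lra.
    have c2 : `|g^`()%classic t - g^`()%classic x| < eta.
      apply: Hd; first exact: cin tc.
      apply: le_lt_trans hd; rewrite ler_norml.
      by move: tc xc; rewrite cS => /andP[? ?] /andP[? ?]; apply/andP; split; lra.
    have -> : cross (g^`()%classic x) (dirv (th j)) = cross (g^`()%classic t)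
        (dirv (th j))
       - cross (g^`()%classic t - g^`()%classic x) (dirv (th j)).
      by rewrite crossBl opprB addrC subrK.
    apply: (le_trans (ler_normB _ _)).
    have c3 : `|cross (g^`()%classic t - g^`()%classic x) (dirv (th j))| <= 2 * eta.
      rewrite /cross; apply: (le_trans (ler_normB _ _)); rewrite !normrM.
      have := ler_pM (normr_ge0 _) (normr_ge0 _) (ltW (le_lt_trans (norm_fst _) c2))
          (sin_max (th j)).
      have := ler_pM (normr_ge0 _) (normr_ge0 _) (ltW (le_lt_trans (norm_snd _) c2))
          (cos_max (th j)).
      rewrite /=; lra.
    lra.
- by move=> j; apply: sumr_ge0 => *; exact: ltW.
- rewrite -hM.
  have -> : \sum_(j < n) \sum_(m < M | A m == j) h = \sum_(m < M)
      \sum_(j < n | A m == j) h.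
    by rewrite (exchange_big_dep predT) //=.
  have -> : h * M%:R = \sum_(m < M) h by rewrite sumr_const card_ord mulr_natr.
  apply: ler_sum => m _; case: (ltnP (A m) n) => Amn.
    by rewrite (big_pred1 (Ordinal Amn)) // => j /=; rewrite -val_eqE /= eq_sym.
  rewrite big_pred0 ?ltW // => j; apply/negbTE; rewrite neq_ltn; apply/orP; right.
  exact: leq_trans (ltn_ord j) Amn.
- move=> t r al tab lal gt.
  have [m mM tm] := @grid_cell _ M a b t (ltn0Sn _) tab.
  exists (A m); first by have [_ H] := HA m; exact: (H t r al).
  by exists m; split => //; exists t => //=; rewrite in_itv.
Qed.

End SplitCurve.

(** * Replacing a segment, for two transversal arcs of directions *)

Section Arcs.
Variable R : realType.

Lemma cross_decomp (p q v : R * R) : cross p q != 0 ->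
  v = (cross v q / cross p q) *: p + (cross p v / cross p q) *: q.
Proof.
case: p q v => [p1 p2] [q1 q2] [v1 v2]; rewrite /cross /= => pq.
by congr pair; rewrite /= /GRing.scale /=; field; exact: pq.
Qed.

Lemma replaceable_sub (Gam Gam' : bool -> set (R * R)) w c :
  (forall b, Gam b `<=` Gam' b) -> replaceable Gam' w c -> replaceable Gam w c.
Proof.
move=> GG H p s t eps tau st e0 t0; have [S [H1 H2 H3]] := H p s t eps tau st e0 t0.
exists S; split => //; apply: area_le_sub H3 => // z [b [x [y [Sx Gy ->]]]].
by exists b, x, y; split => //; exact: GG.
Qed.

Definition arc_part (K : nat) (g : nat -> R -> R * R) (a b : nat -> R)
    (lo hi : R) : set (R * R) :=
  [set z | exists i t r al, [/\ (i < K)%N, a i <= t <= b i, g i t = z,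
     lo <= al <= hi & (g i)^`()%classic t = r *: dirv al]].

(** With [n] small arcs in each arc, [kappa] and [rho] in [replaceable_grid] are
[O(1/n)], and [(1 + rho) ^+ (2 n)] is bounded by [expR (4 * W / c)]; the total
cost is thus [O(1/n)] and can be made smaller than any [e].  An arbitrary
segment is first decomposed along the initial directions of the two arcs. *)
Lemma replaceable_arcs (K : nat) (g : nat -> R -> R * R) (a b : nat -> R)
    (lo hi : bool -> R) (c : R) w :
  (forall i, a i < b i) -> (forall i x, derivable (g i) x 1) ->
  (forall i, continuous (g i)^`()%classic) ->
  (forall e, lo e <= hi e) -> 0 < c ->
  (forall al be, lo true <= al <= hi true -> lo false <= be <= hi false ->
      c <= sin (be - al)) ->
  replaceable (fun e => arc_part K g a b (lo e) (hi e)) w 0.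
Proof.
move=> ab dg cg lohi c0 sep.
suff HR : forall e, 0 < e -> replaceable (fun e => arc_part K g a b (lo e) (hi e)) w e.
  move=> p s t eps tau st e0 t0; have t2 : 0 < tau / 2 by lra.
  have [S [H1 H2 H3]] := HR _ t2 p s t eps _ st e0 t2.
  by exists S; split => //; apply: area_le_sub H3 => //; lra.
move=> e e0.
have /choice[Vi HVi] : forall i, exists V, 0 < V /\ forall x, a i <= x <= b i ->
    `|(g i)^`()%classic x| <= V.
  by move=> i; have [V V0 HV] := bounded_on_segment (a i) (b i) (cg i); exists V.
pose V := \sum_(i < K) Vi i + 1.
have V0 : 0 < V by rewrite ltr_wpDl // sumr_ge0 // => i _; apply: ltW; have [] := HVi i.
have HV i x : (i < K)%N -> a i <= x <= b i -> `|(g i)^`()%classic x| <= V.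
  move=> iK xab; have [_ /(_ x xab)/le_trans] := HVi i; apply.
  rewrite /V (bigD1 (Ordinal iK)) //= -addrA lerDl addr_ge0 // sumr_ge0 // => j _.
  by apply: ltW; have [] := HVi j.
pose Lam := \sum_(i < K) (b i - a i).
have Lam0 : 0 <= Lam by apply: sumr_ge0 => i _; rewrite subr_ge0 ltW.
pose W := (hi true - lo true) + (hi false - lo false) + 1.
have W0 : 0 < W by have := lohi true; have := lohi false; rewrite /W; lra.
pose u0 e := dirv (lo e).
have cr0 : cross (u0 true) (u0 false) != 0.
  rewrite gt_eqF // cross_dirv (lt_le_trans c0) //; apply: sep; by rewrite lexx lohi.
pose x := cross w (u0 false) / cross (u0 true) (u0 false).
pose y := cross (u0 true) w / cross (u0 true) (u0 false).
(* The cost is at most [B / n]. *)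
pose B := 576 * ((2 * V + 2) * W) * (expR (4 * W / c) * (2 * Lam)) * (`|x| + `|y|).
have B0 : 0 <= B.
  rewrite /B; apply: mulr_ge0; last by rewrite addr_ge0.
  apply: mulr_ge0; apply: mulr_ge0; [exact: ler0n| |exact: expR_ge0|exact: mulr_ge0].
  by apply: mulr_ge0; lra.
pose n := (Num.truncn (B / e)).+1.
have Bn : B < e * n%:R.
  by rewrite mulrC -ltr_pdivrMr //; have /andP[] := truncn_itv (divr_ge0 B0 (ltW e0)).
have nz : 0 < n%:R :> R by rewrite ltr0n.
pose eta := W / n%:R.
have eta0 : 0 < eta by rewrite divr_gt0.
have eta_n : eta * n%:R = W by rewrite divfK // gt_eqF.
have Heta e' : (hi e' - lo e') / n%:R <= eta.
  rewrite ler_pM2r ?invr_gt0 // /W.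
  by move: (lohi true) (lohi false) {e0 Bn}; case: e' => /=; lra.
pose th e' j := lo e' + (hi e' - lo e') / n%:R * j%:R.
have th_in e' j : (j <= n)%N -> lo e' <= th e' j <= hi e'.
  move=> jn; have h0 : 0 <= (hi e' - lo e') / n%:R by rewrite divr_ge0 // subr_ge0.
  have h1 : j%:R <= n%:R :> R by rewrite ler_nat.
  have := ler_wpM2l h0 h1; rewrite divfK ?gt_eqF // => h2.
  by rewrite lerDl mulr_ge0 //= /th; lra.
have crc e' i j : (i <= n)%N -> (j <= n)%N ->
    c <= `|cross (dirv (th e' i)) (dirv (th (~~ e') j))|.
  move=> iN jN; rewrite cross_dirv; case: e' => /=.
    by apply: le_trans (ler_norm _); apply: sep; exact: th_in.
  rewrite -[X in sin X]opprB sinN normrN; apply: le_trans (ler_norm _).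
  by apply: sep; exact: th_in.
have /choice[GL HGL] : forall q : bool * nat,
    exists GL : (nat -> set (R * R)) * (nat -> R),
  [/\ (forall j, 0 <= GL.2 j) & (q.2 < K)%N ->
    [/\ forall j, (j < n)%N -> sweep_cost (dirv (th q.1 j)) (GL.1 j)
          (576 * ((2 * V + 2) * eta) * GL.2 j),
        \sum_(j < n) GL.2 j <= b q.2 - a q.2 &
        forall t r al, a q.2 <= t <= b q.2 -> lo q.1 <= al <= hi q.1 ->
          (g q.2)^`()%classic t = r *: dirv al ->
          exists2 j, (j < n)%N & GL.1 j (g q.2 t)]].
  move=> [e' i] /=; case: (ltnP i K) => [iK|_]; last by exists (fun=> set0, fun=> 0).
  have [G [l [H1 H2 H3 H4]]] := split_by_direction (ab i) (dg i) (cg i)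
      (fun x => @HV i x iK) V0
    (ltn0Sn _ : 0 < n)%N eta0 (Heta e').
  by exists (G, l).
pose GG e' j := [set z | exists i, [/\ (i < K)%N, xpredT i & (GL (e', i)).1 j z]].
pose LL e' j := \sum_(i < K) (GL (e', nat_of_ord i)).2 j.
pose kappa := 576 * ((2 * V + 2) * eta).
have kappa0 : 0 <= kappa by apply: mulr_ge0; [exact: ler0n|apply: mulr_ge0; lra].
pose rho := 2 * (eta / c).
have rho0 : 0 <= rho by rewrite mulr_ge0 // divr_ge0 // ltW.
have LL0 e' j : 0 <= LL e' j by apply: sumr_ge0 => i _; case: (HGL (e', nat_of_ord i)).
have kill e' j : (j < n)%N -> sweep_cost (dirv (th e' j)) (GG e' j) (kappa * LL e' j).
  move=> jn; rewrite /LL mulr_sumr.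
  apply: (@sweep_cost_bigU _ _ K xpredT (fun i => (GL (e', i)).1 j)
      (fun i => kappa * (GL (e', i)).2 j)) => i iK _.
  by have [_ /(_ iK)[H _ _]] := HGL (e', i); exact: H.
have turn e' i j : (i < n)%N -> (j <= n)%N -> exists X Y : R,
  dirv (th e' i) = X *: dirv (th e' i.+1) + Y *: dirv
      (th (~~ e') j) /\ `|X| + `|Y| <= 1 + rho.
  move=> iN jN; set p := dirv (th e' i.+1); set q := dirv (th (~~ e') j); set v := dirv _.
  have pq : c <= `|cross p q| by exact: crc.
  have pq0 : cross p q != 0 by rewrite -normr_gt0 (lt_le_trans c0).
  exists (cross v q / cross p q), (cross p v / cross p q); split;
      first exact: cross_decomp.
  have dth : `|th e' i.+1 - th e' i| <= eta.
    have -> : th e' i.+1 - th e' i = (hi e' - lo e') / n%:R by rewrite /th -natr1; ring.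
    by rewrite ger0_norm // divr_ge0 // subr_ge0.
  have h1 : `|cross v q| <= `|cross p q| + eta.
    have := ler_normD (cross v q - cross p q) (cross p q); rewrite subrK => /le_trans;
        apply.
    rewrite addrC lerD2l !cross_dirv; apply: (le_trans (sin_lip _ _)).
    by apply: (le_trans _ dth); rewrite opprB addrC addrA subrK.
  have h2 : `|cross p v| <= eta.
    rewrite cross_dirv; have := sin_lip (th e' i - th e' i.+1) 0.
    by rewrite sin0 !subr0 distrC => /le_trans; apply.
  have cpq : 0 < `|cross p q| by exact: lt_le_trans pq.
  rewrite !normrM normfV.
  have h3 : (`|cross v q| + `|cross p v|) / `|cross p q| <= 1 + 2 * eta / `|cross p q|.
    have -> : 1 + 2 * eta / `|cross p q| = (`|cross p q| + 2 * eta) / `|cross p q|.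
      by rewrite [RHS]mulrDl divff ?gt_eqF.
    by rewrite ler_pM2r ?invr_gt0 //; lra.
  have h4 : 2 * eta / `|cross p q| <= rho.
    by rewrite /rho -mulrA ler_pM2l ?ltr0n // ler_pM2l // lef_pV2 // posrE.
  rewrite -mulrDl; lra.
have tree e' z : replaceable (fun e => arc_part K g a b (lo e) (hi e)) (z *: u0 e')
    (`|z| * (kappa * (expR (4 * W / c) * (2 * Lam)))).
  have := @replaceable_grid R n (fun e' j => dirv (th e' j)) GG LL kappa rho LL0 kappa0
      rho0 _ turn
    (n + n)%N (fun=> 0%N) e' z (fun=> leq0n _) _.
  rewrite /th mulr0 addr0 => H.
  apply: replaceable_le (replaceable_sub _ (H _ _)).
  - apply: ler_wpM2l => //; apply: ler_wpM2l => //; apply: ler_pM.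
    + by rewrite exprn_ge0 // addr_ge0.
    + by apply: sumr_ge0 => ? _; apply: sumr_ge0.
    + have -> : 4 * W / c = (n + n)%:R * rho.
        by rewrite /rho natrD -eta_n; ring.
      rewrite expRM_natl lerXn2r ?nnegrE ?expR_ge0 ?addr_ge0 //; exact: expR_ge1Dx.
    + have LLam e'' : \sum_(0 <= i < n) LL e'' i <= Lam.
        rewrite big_mkord /LL exchange_big /=; apply: ler_sum => i _.
        by have [_ /(_ (ltn_ord i))[_ H1 _]] := HGL (e'', nat_of_ord i).
      by rewrite big_bool /=; have := LLam true; have := LLam false; lra.
  - move=> e'' z' [i [t [r [al [iK tab <- lal gt]]]]].
    have [_ /(_ iK)[_ _ H1]] := HGL (e'', i).
    have [j jn Gj] := H1 t r al tab lal gt.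
    by exists j; split => //; exists i.
  - by move=> *; exact: kill.
  - by rewrite !subn0.
rewrite (cross_decomp w cr0) -/x -/y.
apply: (@replaceable_le _ _ _ (`|x| * (kappa * (expR (4 * W / c) * (2 * Lam))) +
   `|y| * (kappa * (expR (4 * W / c) * (2 * Lam))))).
  rewrite -(ler_pM2r nz) (le_trans _ (ltW Bn)) // /B -eta_n /kappa le_eqVlt; apply/orP;
      left.
  by apply/eqP; ring.
have costE N (v C : R) : N%:R^-1 * (`|v| * C) = `|N%:R^-1 * v| * C.
  by rewrite normrM ger0_norm ?invr_ge0 // mulrA.
apply: replaceable_zigzag => N N0; rewrite scalerA costE; first exact: tree true _.
exact: tree false _.
Qed.

End Arcs.

(** * Replacing a path *)

Section Approximation.
Variable R : realType.

(** The path is replaced by an inscribed polygon with short sides, whose sides are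
then replaced by labelled paths at zero cost. *)
Lemma labelled_approximation (Gam : bool -> set (R * R)) (f : R -> R * R)
    (A B eps delta : R) :
  (forall w, replaceable Gam w 0) -> continuous f -> A < B -> 0 < eps -> 0 < delta ->
  exists (f' : R -> R * R) (S : bool -> set (R * R)) (r : R),
  [/\ [/\ continuous f', f' A = f A & f' B = f B],
      forall x, A <= x <= B -> `|f' x - f x| <= eps,
      0 < r,
      forall x, A <= x <= B -> exists b, [set z | `|z - f' x| < r] `<=` S b &
      area_le (sumset2 S Gam) delta].
Proof.
move=> HR cf AB e0 d0; have e4 : 0 < eps / 4 by lra.
have [d dd Hd] := heine A B cf e4.
pose N := (Num.truncn ((B - A) / d)).+1.
have /andP[_ M2] : (Num.truncn ((B - A) / d))%:R <= (B - A) / d < N%:R.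
  by apply: truncn_itv; rewrite divr_ge0 // ltW // subr_gt0.
have N0 : 0 < N%:R :> R by rewrite ltr0n.
pose h := (B - A) / N%:R.
have h0 : 0 < h by rewrite divr_gt0 // subr_gt0.
have hd : h < d by rewrite /h ltr_pdivrMr // mulrC -ltr_pdivrMr.
have hN : h * N%:R = B - A by rewrite divfK // gt_eqF.
pose T i := A + h * i%:R.
have TS i : T i.+1 = T i + h by rewrite /T -natr1; ring.
have T0 : T 0%N = A by rewrite /T mulr0 addr0.
have TN : T N = B by rewrite /T hN addrC subrK.
have Tin i : (i <= N)%N -> A <= T i <= B.
  move=> iN; have h1 : i%:R <= N%:R :> R by rewrite ler_nat.
  have := ler_wpM2l (ltW h0) h1; rewrite hN => h2.
  by rewrite lerDl mulr_ge0 ?(ltW h0) //= /T; lra.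
have dN : 0 < delta / N%:R by rewrite divr_gt0.
have Tlt i : T i < T i.+1 by rewrite TS ltrDl.
have /choice[S HS] : forall i, exists S,
  [/\ labelled_path (fun=> S) (f (T i)) (f (T i.+1)) (T i) (T i.+1),
     forall b, S b `<=` tube (f (T i)) (f (T i.+1) - f (T i)) (eps / 4) &
     area_le (sumset2 S Gam) (delta / N%:R)].
  move=> i; have := HR _ (f (T i)) _ _ _ _ (Tlt i) e4 dN.
  by move=> /(_ (f (T i.+1) - f (T i)))[S]; rewrite addrC subrK add0r => ?; exists S.
have := @labelled_path_chain R N.-1 (f \o T) T S _ _; rewrite prednK // => -[].
- by move=> i _; apply: ltW.
- by move=> i _; case: (HS i).
move=> f' [r [cf' f'A f'B r0 Hf']].
rewrite T0 in f'A; rewrite TN in f'B.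
exists f', (fun b => [set z | exists2 i, (i < N)%N & S i b z]), r; split => //.
- by rewrite f'A f'B /= T0 TN.
- move=> x xAB; have := Hf' x; rewrite T0 TN => /(_ xAB)[b Hb].
  have [|i [iN xT Sx]] := Hb (f' x); first by rewrite /= subrr normr0.
  have iN' : (i < N)%N by exact: iN.
  have [_ H _] := HS i; have [s /andP[s0 s1] sx] := H _ _ Sx.
  have TiAB := Tin _ (ltnW iN').
  have h1 : `|f (T i) - f x| < eps / 4.
    apply: Hd => //; apply: le_lt_trans hd; rewrite ler_norml.
    by move: xT; rewrite TS => /andP[? ?]; apply/andP; split; lra.
  have h2 : `|f (T i.+1) - f (T i)| <= eps / 4.
    rewrite distrC ltW //; apply: Hd => //.
    by rewrite TS opprD addrA subrr add0r normrN gtr0_norm.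
  set D := f (T i.+1) - f (T i) in sx h2.
  have -> : f' x - f x = (f' x - (f (T i) + s *: D)) + s *: D + (f (T i) - f x).
    by rewrite opprD !addrA !subrK.
  apply: (le_trans (ler_normD _ _)); have :=
      ler_normD (f' x - (f (T i) + s *: D)) (s *: D).
  rewrite normrZ ger0_norm //; have := ler_wpM2r (normr_ge0 D) s1; lra.
- move=> x xAB; have := Hf' x; rewrite T0 TN => /(_ xAB)[b Hb]; exists b.
  by move=> z /Hb[i [iN _ Sz]]; exists i.
- apply: (@area_le_sub _ _ [set z | exists2 i, (i < N)%N & sumset2 (S i) Gam z]
     (\sum_(i < N) (delta / N%:R))).
  + by move=> z [b [x [y [[i iN Sx] Gy ->]]]]; exists i => //; exists b, x, y.
  + by rewrite sumr_const card_ord -[X in X <= _]mulr_natr divfK // gt_eqF.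
  + apply: (@area_le_bigU _ N (fun i => sumset2 (S i) Gam) (fun=> delta / N%:R)) => i iN.
    by case: (HS i).
Qed.

(** The path is made constant outside its interval of parameters, which makes it
continuous on the whole line and allows a degenerate interval to be enlarged. *)
Lemma extend_path (f : R -> R * R) (A B : R) : A <= B -> {within `[A, B], continuous f} ->
  exists (f0 : R -> R * R) (A' B' : R),
      [/\ A' < B', continuous f0, f0 A' = f A, f0 B' = f B &
    f0 @` `[A', B']%classic `<=` f @` `[A, B]%classic].
Proof.
move=> AB cf.
pose cl (x : R) := Num.max A (Num.min x B).
have clin x : `[A, B]%classic (cl x).
  by rewrite /= in_itv /= /cl le_max lexx /= ge_max AB /= ge_min lexx orbT.
exists (f \o cl), A, (B + 1); split.
- lra.
- have ccl : continuous cl.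
    move=> x; apply: (@continuous_max R _ (fun=> A) (fun x => Num.min x B) x);
        first exact: cvg_cst.
    by apply: (@continuous_min R _ id (fun=> B) x); [exact: cvg_id|exact: cvg_cst].
  move=> x.
  have fcl : f @ within `[A, B]%classic (nbhs (cl x)) --> f (cl x).
    have := cf (cl x); rewrite /continuous_at /=.
    by rewrite nbhs_subspace_in.
  apply: (cvg_comp _ _ _ fcl) => P /= wP.
  have h : nbhs x (cl @^-1` (fun y => `[A, B]%classic y -> P y)) := ccl x _ wP.
  change (nbhs x (cl @^-1` P)); apply: filterS h => z H; apply: H; exact: clin.
- by rewrite /= /cl min_l // max_l.
- by rewrite /= /cl min_r ?max_r //; lra.
- by move=> _ [x _ <-]; exists (cl x).
Qed.

End Approximation.

(** * The limit of successive replacements *)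

Section Limit.
Variable R : realType.

(** The state of the iteration is the number of the step, the current path and a
radius [rho].  The next path lies within [rho / 2] of the current one; its radius
is at most [rho / 2], and less than the radius of the balls that certify its
labels.  All later paths, and the limit, then stay within [rho] of the current
path, so that the limit inherits the labels of every step. *)
Lemma limit_path (Gam : nat -> bool -> set (R * R)) (delta : nat -> R) (f0 : R -> R * R)
    (A B e0 : R) :
  (forall m w, replaceable (Gam m) w 0) -> (forall m, 0 < delta m) ->
  continuous f0 -> A < B -> 0 < e0 ->
  exists (F : R -> R * R) (S : nat -> bool -> set (R * R)),
  [/\ [/\ continuous F, F A = f0 A & F B = f0 B],
      forall x, A <= x <= B -> `|F x - f0 x| <= e0,
      forall m x, A <= x <= B -> exists b, (S m b)^° (F x) &
      forall m, area_le (sumset2 (S m) (Gam m)) (delta m)].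
Proof.
move=> HR d0 cf0 AB e00.
pose inv (s : nat * (R -> R * R) * R) :=
  [/\ 0 < s.2, continuous s.1.2, s.1.2 A = f0 A & s.1.2 B = f0 B].
pose next (s s' : nat * (R -> R * R) * R) := [/\ s'.1.1 = s.1.1.+1, s'.2 <= s.2 / 2,
  forall x, A <= x <= B -> `|s'.1.2 x - s.1.2 x| <= s.2 / 2 &
  exists S : bool -> set (R * R), [/\ 
    (forall x, A <= x <= B -> exists b, exists2 r, s'.2 < r &
        [set z | `|z - s'.1.2 x| < r] `<=` S b) &
    area_le (sumset2 S (Gam s.1.1)) (delta s.1.1)]].
have inv0 : inv (0%N, f0, e0) by split.
have [s [s0 sS]] : {s : nat -> {s | inv s} | s 0%N = exist inv _ inv0 /\
   forall n, next (sval (s n)) (sval (s n.+1))}.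
  apply: (dependent_choice (R := fun x y => next (sval x) (sval y))) => -[[[m f] rho] H].
  apply/cid; have [/= rho0 cf fA fB] := H.
  have rho2 : 0 < rho / 2 by lra.
  have [f' [S [r [[cf' f'A f'B] H1 r0 H2 H3]]]] :=
      labelled_approximation (HR m) cf AB rho2 (d0 m).
  have i' : inv (m.+1, f', Num.min (rho / 2) (r / 2)).
    by split => //=; [rewrite lt_min rho2 /=; lra|rewrite f'A|rewrite f'B].
  exists (exist inv _ i'); split => //=; first by rewrite ge_min lexx.
  exists S; split => // x xAB; have [b Hb] := H2 x xAB; exists b, r => //.
  by rewrite gt_min; apply/orP; right; lra.
pose f n := (sval (s n)).1.2; pose rho n := (sval (s n)).2.
have sn n : (sval (s n)).1.1 = n.
  by elim: n => [|n IH]; [rewrite s0|have [-> _ _ _] := sS n; rewrite IH].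
have fI n : inv (sval (s n)) by exact: svalP.
have rho0 n : 0 < rho n by case: (fI n).
have cf n : continuous (f n) by case: (fI n).
have rhoS n : rho n.+1 <= rho n / 2 by case: (sS n).
have fS n x : A <= x <= B -> `|f n.+1 x - f n x| <= rho n / 2 by case: (sS n) =>
    _ _ H _; exact: H.
have /choice[S HS] : forall n, exists S : bool -> set (R * R), 
    (forall x, A <= x <= B -> exists b, exists2 r, rho n.+1 < r &
        [set z | `|z - f n.+1 x| < r] `<=` S b) /\
    area_le (sumset2 S (Gam n)) (delta n).
  by move=> n; have [_ _ _ [S [H1 H2]]] := sS n; rewrite sn in H2; exists S.
(* Clamping the parameter makes the convergence uniform on the whole line. *)
pose cl (x : R) := Num.max A (Num.min x B).
have clin x : A <= cl x <= B.
  by rewrite /cl le_max lexx /= ge_max (ltW AB) /= ge_min lexx orbT.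
have clE x : A <= x <= B -> cl x = x.
  by move=> /andP[h1 h2]; rewrite /cl min_l // max_r.
have ccl : continuous cl.
  move=> x; apply: (@continuous_max R _ (fun=> A) (fun x => Num.min x B) x);
      first exact: cvg_cst.
  by apply: (@continuous_min R _ id (fun=> B) x); [exact: cvg_id|exact: cvg_cst].
have fD k : forall n x, A <= x <= B -> `|f (n + k)%N x - f n x| <= rho n.
  elim: k => [|k IH] n x xAB; first by rewrite addn0 subrr normr0 ltW.
  have := ler_distD (f n.+1 x) (f (n + k.+1)%N x) (f n x).
  rewrite addnS -addSn; have := IH n.+1 x xAB; have := fS n x xAB; have := rhoS n.
  by move=> *; lra.
have rho_small e : 0 < e -> exists n, rho n < e.
  move=> e_0; pose n := Num.bound (e0 / e); exists n.
  have H m : rho m * m%:R <= e0 /\ rho m <= e0.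
    elim: m => [|m [IH1 IH2]]; first by rewrite mulr0 /rho s0 /= lexx ltW.
    have h := rho0 m; have h' := rhoS m; rewrite -natr1 mulrDr mulr1; split; last by lra.
    have hm : 0 <= m%:R :> R by rewrite ler0n.
    have := ler_wpM2r hm h'.
    case: m IH1 IH2 h h' hm => [|m] IH1 IH2 h h' hm; first by rewrite !mulr0; lra.
    have : 1 <= m.+1%:R :> R by rewrite ler1n.
    nra.
  have [H1 _] := H n.
  have nb : e0 / e < n%:R by apply: archi_boundP; rewrite divr_ge0 // ltW.
  have n0 : 0 < n%:R :> R by apply: le_lt_trans nb; rewrite divr_ge0 // ltW.
  rewrite -(ltr_pM2r n0) (le_lt_trans H1) // mulrC -ltr_pdivrMr //.
have cvgF (c : R * R -> R) : (forall v w, `|c v - c w| <= `|v - w|) ->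
    forall x, exists l : R, forall n, `|l - c (f n (cl x))| <= rho n.
  move=> Hc x.
  have cv : cvg ((fun n => c (f n (cl x)) : R) @ \oo).
    apply/cauchy_cvgP; apply: cauchy_exP => e e_0.
    have [n ne] := rho_small e e_0; exists (c (f n (cl x))).
    exists n => // m /= nm; rewrite /ball /= distrC.
    by apply: (le_lt_trans (Hc _ _)); apply: le_lt_trans ne; rewrite -(subnKC nm);
        exact: fD.
  exists (lim ((fun n => c (f n (cl x)) : R) @ \oo)) => n.
  apply/ler_addgt0Pr => e e_0.
  have /cvgrPdist_le/(_ _ e_0)[m _ /(_ (n + m)%N)/=] := cv.
  rewrite leq_addl => /(_ isT) h1; have h2 := le_trans (Hc _ _) (fD m n _ (clin x)).
  by apply: (le_trans (ler_distD (c (f (n + m)%N (cl x))) _ _)); lra.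
have /choice[F1 HF1] := cvgF fst (fun v w => norm_fst (v - w)).
have /choice[F2 HF2] := cvgF snd (fun v w => norm_snd (v - w)).
pose F x := (F1 x, F2 x).
have HF n x : `|F x - f n (cl x)| <= rho n by apply: normr_prod_le;
    [exact: HF1|exact: HF2].
have Feq x c : (forall n, f n (cl x) = c) -> F x = c.
  move=> H; apply/eqP; rewrite -subr_eq0 -normr_le0; apply/ler_addgt0Pr => e e_0.
  have [n ne] := rho_small e e_0; have := HF n x; rewrite H add0r => /le_trans; apply;
      exact: ltW.
exists F, S; split.
- split.
  + move=> x; apply/cvgrPdist_lt => /= e e_0.
    have e3 : 0 < e / 3 by lra.
    have [n ne] := rho_small _ e3.
    have cc : {for x, continuous (f n \o cl)} by apply: continuous_comp;
        [exact: ccl|exact: cf].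
    have /cvgrPdist_lt/(_ _ e3) := cc; apply: filterS => y /= h.
    have := ler_distD (f n (cl x)) (F x) (F y).
    have := ler_distD (f n (cl y)) (f n (cl x)) (F y).
    have := HF n x; have := HF n y; rewrite (distrC (F y)); lra.
  + apply: Feq => n; rewrite clE; first by case: (fI n).
    by rewrite lexx ltW.
  + apply: Feq => n; rewrite clE; first by case: (fI n).
    by rewrite lexx ltW.
- by move=> x xAB; have := HF 0%N x; rewrite clE // /f /rho s0.
- move=> n x xAB; have [H _] := HS n; have [b [r rr Hb]] := H x xAB; exists b.
  have := HF n.+1 x; rewrite clE // => Fx.
  apply/nbhs_ballP; exists (r - rho n.+1); first by rewrite /= subr_gt0.
  move=> z; rewrite -ball_normE /= => Fz; apply: Hb => /=.
  have := ler_distD (F x) z (f n.+1 x); rewrite (distrC z (F x)); lra.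
- by move=> n; case: (HS n).
Qed.

End Limit.

(** * Directions as angles modulo pi *)

Section Directions.
Variable R : realType.

Definition pi1 (x : R) : P1 R := \pi_(P1 R)%qT x.

Lemma pi1_eq (x : R) (k : int) : pi1 (x + k%:~R * pi) = pi1 x.
Proof.
apply/(@eqmodP _ (mod_pi R)); rewrite /= /mod_pi /=.
rewrite addrC addKr mulfK; first exact: intr_int.
by rewrite gt_eqF // pi_gt0.
Qed.

Lemma dirv_addnpi (x : R) (n : nat) : dirv (x + n%:R * pi) = (-1) ^+ n *: dirv x.
Proof.
elim: n => [|n IH]; first by rewrite mul0r addr0 expr0 scale1r.
have -> : x + n.+1%:R * pi = (x + n%:R * pi) + pi by rewrite -natr1; ring.
have -> : forall y : R, dirv (y + pi) = -1 *: dirv y.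
  by move=> y; rewrite /dirv sinDpi cosDpi scaleN1r.
by rewrite IH scalerA exprS.
Qed.

Lemma dirv_addzpi (x : R) (k : int) : exists s : R, dirv (x + k%:~R * pi) = s *: dirv x.
Proof.
case: k => n; first by exists ((-1) ^+ n); rewrite -dirv_addnpi.
exists ((-1) ^+ n.+1).
have {2}-> : x = (x + (Negz n)%:~R * pi) + n.+1%:R * pi.
  by rewrite NegzE mulrNz mulNr; exact: (esym (subrK _ _)).
by rewrite dirv_addnpi scalerA -exprMn mulN1r opprK expr1n scale1r.
Qed.

Lemma angle_mod_pi (x : R) : exists (y s : R),
  [/\ 0 <= y < pi, pi1 x = pi1 y & dirv x = s *: dirv y].
Proof.
have pi0 := pi_gt0 R.
pose k := Num.floor (x / pi); pose y := x - k%:~R * pi.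
have xE : x = y + k%:~R * pi by rewrite /y subrK.
have [s Hs] := dirv_addzpi y k.
exists y, s; split; [|by rewrite xE pi1_eq|by rewrite xE Hs].
have /andP[h1 h2] := floor_itv (x / pi).
rewrite subr_ge0 -ler_pdivlMr // h1 /= ltrBlDl -[X in _ + X]mul1r -mulrDl -ltr_pdivrMr //.
by rewrite intrD in h2.
Qed.

Lemma measurable_pi1 :
  @measurable_fun _ _ (measurableTypeR R) (g_sigma_algebraType (@open (P1 R))) setT pi1.
Proof.
apply: (@measurability _ _ (measurableTypeR R)
    (g_sigma_algebraType (@open (P1 R))) setT pi1 (@open (P1 R))) => // _ [V oV <-];
        rewrite setTI.
apply: open_measurable; apply: (open_comp _ oV) => x _; exact: pi_continuous.
Qed.

Lemma borel_pi1 (D : set (R * R)) (h : R * R -> R) :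
  (forall c, @measurable _ (g_sigma_algebraType (@open (R * R)%type))
      (D `&` [set p | c < h p])) ->
  borel_map D (fun p => pi1 (h p)).
Proof.
move=> H.
have mh : @measurable_fun _ _ (g_sigma_algebraType (@open (R * R)%type))
    (measurableTypeR R) D h.
  apply: (@measurability _ _ (g_sigma_algebraType (@open (R * R)%type))
      (measurableTypeR R) D h (@RGenOInfty.G R)); first exact: RGenOInfty.measurableE.
  move=> _ [_ [c ->] <-]; have := H c.
  by rewrite (_ : D `&` [set p | c < h p] = D `&` h @^-1` `]c, +oo[%classic) //;
    apply/seteqP; split => p [Dp] /=; rewrite in_itv /= andbT.
apply: (@measurable_comp _ _ _ _ _ _ setT) measurable_pi1 mh => //.
Qed.

End Directions.

(** * Paths with a null sweep away from one direction *)

Section NullSweep.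
Variable R : realType.

Lemma uniform_nbhd (f : R -> R * R) (a b : R) (N : set (R * R)) :
  continuous f -> f @` `[a, b]%classic `<=` N^° ->
  exists2 e, 0 < e & forall x z, a <= x <= b -> `|z - f x| <= e -> N z.
Proof.
move=> cf fN.
have /compact_near_coveringP nc := @segment_compact R a b.
pose P (d x : R) := forall z, `|z - f x| <= d -> N z.
have near0 : \forall d \near (0 : R)^'+, `[a, b]%classic `<=` P d.
  apply: nc => x xab.
  have /nbhs_ballP[e /= e0 He] : N^° (f x) by apply: fN; exists x.
  have e2 : 0 < e / 2 by lra.
  have /cvgrPdist_lt/(_ _ e2)/nbhs_ballP[d /= d0 Hd] := cf x.
  exists (ball x d, [set z : R | z < e / 2]) => /=.
    by split; [exact: nbhsx_ballx|exact: nbhs_right_lt].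
  move=> [x' d'] /= [xx' dd'] z zx; apply: He; rewrite -ball_normE /=.
  have := ler_distD (f x') (f x) z; have := Hd _ xx'; rewrite (distrC (f x') z) /=; lra.
have /filter_ex[d [d0 Hd]] : \forall d \near (0 : R)^'+,
    0 < d /\ `[a, b]%classic `<=` P d.
  by apply: filterI => //; exact: nbhs_right_gt.
by exists d => // x z xab; apply: Hd; rewrite /= in_itv.
Qed.

(** The triple [T = (q, q', r)] encodes the arc [[0, q]], labelled [true], and the
arc [[q', r]], labelled [false].  Keeping [r] below [pi] separates them modulo
[pi] as well. *)
Definition separated_arcs (T : rat * rat * rat) :=
  [/\ 0 <= ratr T.1.1 :> R, ratr T.1.1 < ratr T.1.2 :> R, ratr T.1.2 < ratr T.2 :> R &
      ratr T.2 < pi :> R].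

Definition arc_lo (T : rat * rat * rat) (e : bool) : R := if e then 0 else ratr T.1.2.
Definition arc_hi (T : rat * rat * rat) (e : bool) : R :=
    if e then ratr T.1.1 else ratr T.2.

Lemma replaceable_rat_arcs (K : nat) (g : nat -> R -> R * R) (a b : nat -> R) T w :
  (forall n, C1_curve (g n) (a n) (b n)) -> separated_arcs T ->
  replaceable (fun e => arc_part K g a b (arc_lo T e) (arc_hi T e)) w 0.
Proof.
move=> C1 [h0 h1 h2 h3].
have [||c c0 Hc] := @sin_lbound R (ratr T.1.2 - ratr T.1.1) (ratr T.2) _ _ h3; [lra|lra|].
apply: (@replaceable_arcs R K g a b (arc_lo T) (arc_hi T) c).
- by move=> i; case: (C1 i).
- by move=> i; case: (C1 i).
- by move=> i; case: (C1 i).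
- by case; rewrite /arc_lo /arc_hi //; exact: ltW.
- exact: c0.
- rewrite /arc_lo /arc_hi => al be /andP[? ?] /andP[? ?]; apply: Hc.
  by apply/andP; split; lra.
Qed.

(** The [k]-th step for the triple [T] has the number [pickle (T, k)]; it handles
the first [k + 1] curves with an area of at most [2 ^- k.+1].  The arc [e] of
[T] is killed at a point that carries the label [e] for infinitely many [k]. *)
Lemma null_sweep_path (g : nat -> R -> R * R) (a b : nat -> R) (f0 : R -> R * R)
    (A B e0 : R) :
  (forall n, C1_curve (g n) (a n) (b n)) -> continuous f0 -> A < B -> 0 < e0 ->
  exists (F : R -> R * R) (h : R * R -> R),
  [/\ [/\ continuous F, F A = f0 A & F B = f0 B],
      forall x, A <= x <= B -> `|F x - f0 x| <= e0,
      forall c, @measurable _ (g_sigma_algebraType (@open (R * R)%type))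
          (F @` `[A, B]%classic `&` [set p | c < h p]) &
      lebesgue2_null [set z | exists p x, [/\ (F @` `[A, B]%classic) p,
         (exists i t r al, [/\ a i <= t <= b i, g i t = x, 0 <= al < pi,
             (g i)^`()%classic t = r *: dirv al & al <> h p]) & z = p + x]]].
Proof.
move=> C1 cf0 AB e00.
pose dec m : option (rat * rat * rat * nat) := unpickle m.
pose Gam m : bool -> set (R * R) := if dec m is Some (T, k) then
   if `[< separated_arcs T >] then
       (fun e => arc_part k.+1 g a b (arc_lo T e) (arc_hi T e)) else fun=> set0
  else fun=> set0.
pose delta m : R := if dec m is Some (T, k) then 1 / (2 ^ k.+1)%:R else 1.
have HR m w : replaceable (Gam m) w 0.
  have R0 : replaceable (fun=> set0) w 0 by apply: (@replaceable_done _ _ _ true).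
  rewrite /Gam; case: (dec m) => [[T k]|] //; case: asboolP => // Tok;
      exact: replaceable_rat_arcs.
have d0 m : 0 < delta m.
  by rewrite /delta; case: (dec m) => [[T k]|] //; rewrite divr_gt0 // ltr0n expn_gt0.
have [F [S [FH Fe Fb Fc]]] := limit_path HR d0 cf0 AB e00.
have [idx decK] : exists idx : rat * rat * rat -> nat -> nat,
    forall T k, dec (idx T k) = Some (T, k).
  by exists (fun T k => pickle (T, k)) => T k; exact: pickleK.
pose killed T e := lim_sup_set (fun k => (S (idx T k) e)^°).
pose Ks p : set R := [set s | s = 0 \/ exists T,
    [/\ separated_arcs T, s = ratr T.1.1 & killed T true p]].
have Ks0 p : Ks p !=set0 by exists 0; left.
have Ksub p : has_ubound (Ks p).
  exists pi => s [->|[T [[? ? ? ?] -> _]]]; first exact: pi_ge0.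
  lra.
pose h p := sup (Ks p).
exists F, h; split => //.
- move=> c.
  (* For [c >= 0], [h > c] exactly where an arc [[0, q]] with [q > c] is killed. *)
  pose Z j : set (R * R) := if unpickle j is Some T then 
    (if `[< separated_arcs T /\ c < ratr T.1.1 >] then killed T true else set0) else set0.
  have cP : compact (F @` `[A, B]%classic).
    apply: continuous_compact; last exact: segment_compact.
    by apply: continuous_subspaceT; case: FH.
  have mP : @measurable _ (g_sigma_algebraType (@open (R * R)%type))
      (F @` `[A, B]%classic).
    rewrite -[X in measurable X]setCK; apply: measurableC.
    apply: sub_sigma_algebra; apply: closed_openC; apply: compact_closed => //.
  have mK T : @measurable _ (g_sigma_algebraType (@open (R * R)%type)) (killed T true).
    apply: bigcap_measurable => // n _; apply: bigcup_measurable => k _.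
    by apply: sub_sigma_algebra; exact: open_interior.
  have mZ : @measurable _ (g_sigma_algebraType (@open (R * R)%type)) (\bigcup_j Z j).
    apply: bigcup_measurable => j _; rewrite /Z; case: unpickle => [T|];
        last exact: measurable0.
    by case: ifP => _; [exact: mK|exact: measurable0].
  case: (ltP c 0) => c0.
    rewrite (_ : _ `&` _ = F @` `[A, B]%classic) //.
    apply/seteqP; split => p; first by case.
    move=> Fp; split => //=; apply: lt_le_trans c0 _; apply: ub_le_sup => //; by left.
  rewrite (_ : _ `&` _ = F @` `[A, B]%classic `&` \bigcup_j Z j);
      first exact: measurableI.
  congr (_ `&` _); apply/seteqP; split => p.
    move=> /= /(sup_gt (Ks0 p))[s Ks_s cs].
    case: Ks_s cs => [->|[T [Tok -> KT]]] cs; first by move: (lt_le_trans cs c0);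
        rewrite ltxx.
    exists (pickle T); first exact: I.
    by rewrite /Z pickleK; case: asboolP => // nT; case: nT.
  move=> [j _]; rewrite /Z; case: unpickle => // T; case: asboolP => // -[Tok cT] KT /=.
  by apply: lt_le_trans cT _; apply: ub_le_sup => //; right; exists T.
- pose W T := lim_sup_set (fun k => sumset2 (S (idx T k)) (Gam (idx T k))).
  have WN T : lebesgue2_null (W T).
    apply: limsup_null => k; have := Fc (idx T k); by rewrite /delta decK.
  pose ZW j := if unpickle j is Some T then W T else set0.
  have ZN : lebesgue2_null (\bigcup_j ZW j).
    apply: negligible_bigcup => j; rewrite /ZW; case: unpickle => [T|]; first exact: WN.
    exact: negligible_set0.
  apply: (negligibleS _ ZN) => z [_
      [x [[tau tAB <-] [i [t [r [al [tab gt /andP[al0 alpi] g't alh]]]]] ->]]].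
  have kill T e : separated_arcs T -> arc_lo T e <= al <= arc_hi T e ->
      killed T e (F tau) ->
      (\bigcup_j ZW j) (F tau + x).
    move=> Tok alT KT; exists (pickle T); first exact: I.
    rewrite /ZW pickleK => n _.
    have [k /= nk Sk] := KT (maxn n i) I.
    exists k; first by exact: leq_trans (leq_maxl _ _) nk.
    exists e, (F tau), x; split; [exact: interior_subset Sk| |by []].
    rewrite /Gam decK; case: asboolP => // _; exists i, t, r, al; split => //.
    by rewrite ltnS; exact: leq_trans (leq_maxr _ _) nk.
  have hFt s : Ks (F tau) s -> s <= h (F tau) by apply: ub_le_sup.
  have [alh'|halt] : al < h (F tau) \/ h (F tau) < al.
    by apply/orP; rewrite -neq_lt; apply/eqP.
  + have [s Ks_s als] := sup_gt (Ks0 _) alh'.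
    case: Ks_s als => [->|[T [Tok -> KT]]] als; first by move: (lt_le_trans als al0);
        rewrite ltxx.
    by apply: (kill T true) => //; rewrite /arc_lo /arc_hi al0 ltW.
  (* [[0, q1]] is not killed since [q1 > h], hence [[q2, q3]] is. *)
  + have h0 : 0 <= h (F tau) by apply: hFt; left.
    have [q2] := rat_in_itvoo halt; rewrite in_itv /= => /andP[q21 q22].
    have [q1] := rat_in_itvoo q21; rewrite in_itv /= => /andP[q11 q12].
    have [q3] := rat_in_itvoo alpi; rewrite in_itv /= => /andP[q31 q32].
    have Tok : separated_arcs (q1, q2, q3) by split => /=; lra.
    have nK : ~ killed (q1, q2, q3) true (F tau).
      move=> KT; have : ratr q1 <= h (F tau) by apply: hFt; right; exists (q1, q2, q3).
      by rewrite leNgt q11.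
    apply: (kill (q1, q2, q3) false) => //; first by rewrite /arc_lo /arc_hi /= !ltW.
    move=> n _; apply: contrapT => Hn; apply: nK => m _.
    exists (maxn m n); first exact: leq_maxl.
    have [] := Fb (idx (q1, q2, q3) (maxn m n)) tau; first by move: tAB;
        rewrite /= in_itv.
    case => // Sf; exfalso; apply: Hn; exists (maxn m n) => //; exact: leq_maxr.
Qed.

End NullSweep.

Theorem theorem6p2 (R : realType) (E : set (R * R)) (theta : R * R -> P1 R)
    (hE : rectifiable E) (htheta : tangent_field E theta) :
  exists E0 : set (R * R),
    [/\ E0 `<=` E,
        full_H1_measure E E0 &
        forall (P0 : set (R * R)) (p0 q0 : R * R), is_path P0 p0 q0 ->
        forall N : set (R * R), P0 `<=` N° ->
        exists P : set (R * R),
          [/\ is_path P p0 q0,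
              P `<=` N &
              exists phi : R * R -> P1 R,
                borel_map P phi /\
                lebesgue2_null
                  (\bigcup_(p in P)
                     [set p + x | x in [set x | E0 x /\ theta x <> phi p]])]].
Proof.
have [g [a [b [C1 gE]]]] := hE.
pose bad n := [set x | E x /\ exists t, [/\ t \in `[a n, b n], g n t = x &
   ~ is_direction ((g n)^`()%classic t) (theta x)]].
exists [set x | E x /\ exists n t, [/\ t \in `[a n, b n], g n t = x &
   is_direction ((g n)^`()%classic t) (theta x)]]; split.
- by move=> x [].
- pose exceptional n := if n is n'.+1 then bad n' else E `\` \bigcup_n
    (g n @` `[a n, b n]).
  apply: (@hausdorff1_sub0 _ _ (\bigcup_n exceptional n)); last first.
    by apply: hausdorff1_bigcup0 => -[|n] //; exact: htheta.
  move=> x [Ex nE0]; have [[n _ [t tab gt]]|H] :=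
      pselect ((\bigcup_n (g n @` `[a n, b n])) x).
    exists n.+1 => //; split => //; exists t; split => // dt.
    by apply: nE0; split => //; exists n, t.
  by exists 0%N.
- move=> P0 p0 q0 [A [B [f [AB cf -> fA fB]]]] N PN.
  have [f0 [A' [B' [AB' cf0 f0A f0B f0P]]]] := extend_path AB cf.
  have [e e0 He] := uniform_nbhd cf0 (subset_trans f0P PN).
  have [F [h [[cF FA FB] Fe mh null]]] := null_sweep_path C1 cf0 AB' e0.
  exists (F @` `[A', B']%classic); split.
  + exists A', B', F; split => //.
    * exact: ltW.
    * exact: continuous_subspaceT.
    * by rewrite FA f0A.
    * by rewrite FB f0B.
  + move=> _ [t tab <-]; move: tab; rewrite /= in_itv /= => tab.
    by apply: (He t) => //; exact: Fe.
  + exists (fun p => pi1 (h p)); split; first exact: borel_pi1.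
    apply: (negligibleS _ null) => z
        [p Pp [x [[Ex [n [t [tab gt [_ [r [al [thx g't]]]]]]]] thn] <-]].
    exists p, x; split => //.
    have [y [s [y0 yE dE]]] := angle_mod_pi al.
    exists n, t, (r * s), y; split => //.
    * by rewrite -scalerA -dE; exact: g't.
    * by move=> yh; apply: thn; rewrite thx -yh -yE.
Qed.
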